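(* Let $G=\mathbb{Z}_2$, $0<\beta<\beta_0^{(\mathrm{conf})}$ and $\kappa>0$. Let $(R_n)_{n\ge1}$ and $(T_n)_{n\ge1}$ be increasing sequences of positive integers such that $\limsup_{n\to\infty}T_n/R_n<\infty$, and for each $n\ge1$ let $\gamma_1^{(n)},\gamma_2^{(n)}$ be the two halves of the $2R_n\times T_n$ rectangular loop $\gamma^{(n)}=\gamma_1^{(n)}+\gamma_2^{(n)}$ described in the context. Put $$\rho(\gamma_1^{(n)},\gamma_2^{(n)})=\frac{\langle W_{\gamma_1^{(n)}}(\sigma,\phi)\rangle_{\beta,\kappa}\,\langle W_{\gamma_2^{(n)}}(\sigma,\phi)\rangle_{\beta,\kappa}}{\langle W_{\gamma^{(n)}}(\sigma)\rangle_{\beta,\kappa}}.$$ Then the following hold. (i) The limit $\rho=\rho_{\beta,\kappa}:=\lim_{n\to\infty}\rho(\gamma_1^{(n)},\gamma_2^{(n)})$ exists and is independent of $(R_n)_{n\ge1}$ and $(T_n)_{n\ge1}$. (ii) The limit $\rho$ is strictly positive, i.e. $\rho>0$.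
   Context: **Lattice and forms.** Fix $m\ge3$ and let $B_N=[-N,N]^m\cap\mathbb{Z}^m$. $C_0(B_N),C_1(B_N),C_2(B_N)$ are the sets of oriented vertices, nearest-neighbour edges and plaquettes ($2$-cells) with all endpoints in $B_N$ (both orientations). $\Omega^k(B_N,\mathbb{Z}_2)$ is the set of functions $\omega:C_k(B_N)\to\mathbb{Z}_2$ with $\omega(-c)=-\omega(c)$. For $\sigma\in\Omega^1(B_N,\mathbb{Z}_2)$ and a plaquette $p$, $d\sigma(p)=\sum_{e\in\partial p}\sigma(e)$; for $\phi\in\Omega^0(B_N,\mathbb{Z}_2)$ and an edge $e$ from $x_1$ to $x_2$, $\phi(\partial e)=\phi(x_2)-\phi(x_1)$. **Model.** The lattice Higgs model with structure group $\mathbb{Z}_2$ (representation $g\mapsto(-1)^g$) is the probability measure on $\Omega^1(B_N,\mathbb{Z}_2)\times\Omega^0(B_N,\mathbb{Z}_2)$ with $$\mu_{N,\beta,\kappa}(\sigma,\phi)\propto\exp\Bigl(\beta\sum_{p\in C_2(B_N)}(-1)^{d\sigma(p)}+\kappa\sum_{e\in C_1(B_N)}(-1)^{\sigma(e)-\phi(\partial e)}\Bigr),$$ with expectation $\mathbb{E}_{N,\beta,\kappa}$, and $\langle f\rangle_{\beta,\kappa}=\lim_{N\to\infty}\mathbb{E}_{N,\beta,\kappa}[f]$ for $f$ depending on finitely many spins (this limit exists and is translation invariant). A path is a finitely supported $1$-chain $\gamma$ (formal integer combination of positively oriented edges) with coefficients in $\{-1,0,1\}$; it is a loop if $\partial\gamma=0$.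 The Wilson line observable is $W_\gamma(\sigma,\phi)=(-1)^{\sigma(\gamma)-\phi(\partial\gamma)}$; for a loop it does not depend on $\phi$ and is written $W_\gamma(\sigma)$. **The paths.** $\gamma^{(n)}$ is the (counterclockwise oriented) boundary of an axis-parallel rectangle in a coordinate plane with corners $(0,0),(T_n,0),(T_n,2R_n),(0,2R_n)$. $\gamma_1^{(n)}$ is the part of it going from $(0,R_n)$ via $(0,0)$ and $(T_n,0)$ to $(T_n,R_n)$, and $\gamma_2^{(n)}=\gamma^{(n)}-\gamma_1^{(n)}$. ''Increasing'' means strictly increasing. **$\beta_0^{(\mathrm{conf})}$.** With $M_2=8m-12$ and $\varphi_\beta(1)=\tanh(2\beta)$, $$\beta_0^{(\mathrm{conf})}=\sup\Bigl\{\beta\ge0:\ M_2^2\varphi_\beta(1)<1\ \text{ and there is }\alpha\in(0,1)\text{ such that }\frac{M_2^3\varphi_\beta(1)^{1-\alpha}}{1-M_2^2\varphi_\beta(1)^{1-\alpha}}<2\alpha\Bigr\}.$$ *)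

(* Defs.v *)
From mathcomp Require Import all_boot all_order all_algebra finmap.
From mathcomp Require Import all_classical all_reals all_analysis.
From mathcomp.multinomials Require Import freeg.
From mathcomp Require Import zify.
Set Implicit Arguments.
Unset Strict Implicit.
Unset Printing Implicit Defensive.
Import Order.TTheory GRing.Theory Num.Theory.
Import numFieldNormedType.Exports.
Local Open Scope classical_set_scope.
Local Open Scope fset_scope.
Local Open Scope ring_scope.

Notation site m := 'rV[int]_m (only parsing).

Definition unitv (m : nat) (i : 'I_m) : site m := delta_mx 0 i.

(* [(x, i)] is the edge from x to x + e_i; [(x, i, j)], used for i < j only, is
   the unit square with corners x, x + e_i, x + e_i + e_j, x + e_j. *)
Notation pedge m := (site m * 'I_m)%type (only parsing).
Notation pplaq m := (site m * 'I_m * 'I_m)%type (only parsing).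

(* [(true, c)] is the positively oriented cell c, [(false, c)] is -c. *)
Notation oriented K := (bool * K)%type (only parsing).

Definition pos {K : Type} (c : K) : oriented K := (true, c).
Definition opp {K : Type} (c : oriented K) : oriented K := (~~ c.1, c.2).

Definition src (m : nat) (e : oriented (pedge m)) : site m :=
  if e.1 then e.2.1 else e.2.1 + unitv e.2.2.
Definition tgt (m : nat) (e : oriented (pedge m)) : site m :=
  if e.1 then e.2.1 + unitv e.2.2 else e.2.1.

Definition corners (m : nat) (p : oriented (pplaq m)) : seq (site m) :=
  let: (_, (x, i, j)) := p in
  [:: x; x + unitv i; x + unitv i + unitv j; x + unitv j].

Definition plaq_bd (m : nat) (p : oriented (pplaq m)) :
    seq (oriented (pedge m)) :=
  let: (s, (x, i, j)) := p in
  let bd := [:: pos (x, i); pos (x + unitv i, j);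
                opp (pos (x + unitv j, i)); opp (pos (x, j))] in
  if s then bd else [seq opp e | e <- bd].

Definition box (m N : nat) : {fset site m} :=
  [fset (map_mx (fun k : 'I_(N.*2.+1) => (k : nat)%:Z - N%:Z) v : site m)
     | v in {: 'rV['I_(N.*2.+1)]_m}].

Lemma in_box (m N : nat) (x : site m) :
  (x \in box m N) = [forall i, - N%:Z <= x 0 i <= N%:Z].
Proof.
apply/idP/forallP => [/imfsetP[v _ ->] i | xN].
  rewrite mxE; move: (v 0 i) => -[k /= kN]; lia.
pose v : 'rV['I_(N.*2.+1)]_m := \row_i inord (absz (x 0 i + N%:Z)).
apply/imfsetP; exists v => //=; apply/rowP => i.
by rewrite !mxE inordK; have := xN i; lia.
Qed.

Definition signs : {fset bool} := [fset s in {: bool}].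
Definition dirs (m : nat) : {fset 'I_m} := [fset i in {: 'I_m}].

Definition C0 (m N : nat) : {fset oriented (site m)} := signs `*` box m N.

Definition C1 (m N : nat) : {fset oriented (pedge m)} :=
  [fset e in signs `*` (box m N `*` dirs m)
     | (src e \in box m N) && (tgt e \in box m N)].

Definition C2 (m N : nat) : {fset oriented (pplaq m)} :=
  [fset p in signs `*` (box m N `*` dirs m `*` dirs m)
     | (p.2.1.2 < p.2.2)%N && all (mem (box m N)) (corners p)].

Definition forms (K : choiceType) (C : {fset oriented K}) :
    {set {ffun C -> 'Z_2}} :=
  [set w : {ffun C -> 'Z_2} | [forall c : C, forall c' : C,
      (val c' == opp (val c)) ==> (w c' == - w c)]]%SET.

(* Forms on a box are extended by 0 in order to be evaluated on any cell. *)
Definition ext (K : choiceType) (C : {fset oriented K})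
    (w : {ffun C -> 'Z_2}) (c : oriented K) : 'Z_2 :=
  if (insub c : option C) is Some c' then w c' else 0.

Definition d1 (m : nat) (sigma : oriented (pedge m) -> 'Z_2)
    (p : oriented (pplaq m)) : 'Z_2 :=
  \sum_(e <- plaq_bd p) sigma e.

Definition d0 (m : nat) (phi : oriented (site m) -> 'Z_2)
    (e : oriented (pedge m)) : 'Z_2 :=
  phi (pos (tgt e)) - phi (pos (src e)).

Definition rep {R : realType} (g : 'Z_2) : R := (-1) ^+ (g : nat).

Section Model.
Variables (R : realType) (m : nat).

Definition observable : Type :=
  (oriented (pedge m) -> 'Z_2) -> (oriented (site m) -> 'Z_2) -> R.

Local Notation config N :=
  ({ffun C1 m N -> 'Z_2} * {ffun C0 m N -> 'Z_2})%type.

Definition configs (N : nat) : {set config N} :=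
  finset.setX (forms (C1 m N)) (forms (C0 m N)).

Definition gibbs (N : nat) (beta kappa : R) (w : config N) : R :=
  expR (beta * (\sum_(p : C2 m N) rep (d1 (ext w.1) (val p)))
      + kappa * (\sum_(e : C1 m N) rep (w.1 e - d0 (ext w.2) (val e)))).

Definition mu (N : nat) (beta kappa : R) (w : config N) : R :=
  gibbs beta kappa w / \sum_(w' in configs N) gibbs beta kappa w'.

Definition expect (N : nat) (beta kappa : R) (f : observable) : R :=
  \sum_(w in configs N) mu beta kappa w * f (ext w.1) (ext w.2).

(* [lim] is total: it is the limit when the expectations converge, which is the
   case for observables depending on finitely many spins. *)
Definition infvol (beta kappa : R) (f : observable) : R :=
  lim (expect N beta kappa f @[N --> \oo]).

End Model.

Notation chain1 m := {freeg (pedge m) / int} (only parsing).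
Notation chain0 m := {freeg (site m) / int} (only parsing).

Definition eval_chain (K : choiceType) (w : oriented K -> 'Z_2)
    (c : {freeg K / int}) : 'Z_2 :=
  \sum_(k <- freeg.dom c) w (pos k) *~ coeff k c.

Definition bd1 (m : nat) (gamma : chain1 m) : chain0 m :=
  \sum_(e <- freeg.dom gamma)
     (<< tgt (pos e) >> - << src (pos e) >>) *~ coeff e gamma.

Definition wilson {R : realType} (m : nat) (gamma : chain1 m) :
    observable R m :=
  fun sigma phi => rep (eval_chain sigma gamma - eval_chain phi (bd1 gamma)).

Definition segment (m : nat) (x : site m) (i : 'I_m) (L : nat) : chain1 m :=
  \sum_(k < L) << (x + unitv i *+ k, i) >>.

(* The rectangle with corners 0, T e_i, T e_i + 2r e_j, 2r e_j. *)
Definition rect (m : nat) (i j : 'I_m) (r T : nat) : chain1 m :=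
  segment 0 i T + segment (unitv i *+ T) j (2 * r)
  - segment (unitv j *+ (2 * r)) i T - segment 0 j (2 * r).

(* From r e_j via 0 and T e_i to T e_i + r e_j. *)
Definition rect1 (m : nat) (i j : 'I_m) (r T : nat) : chain1 m :=
  segment 0 i T + segment (unitv i *+ T) j r - segment 0 j r.

Definition rect2 (m : nat) (i j : 'I_m) (r T : nat) : chain1 m :=
  rect i j r T - rect1 i j r T.

Definition rho {R : realType} (m : nat) (beta kappa : R) (i j : 'I_m)
    (r T : nat) : R :=
  infvol beta kappa (wilson (rect1 i j r T)) *
  infvol beta kappa (wilson (rect2 i j r T)) /
  infvol beta kappa (wilson (rect i j r T)).

Definition tanh {R : realType} (x : R) : R :=
  (expR x - expR (- x)) / (expR x + expR (- x)).

(* The denominator is not required to be positive: as in the source, the last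
   inequality is also satisfied when the left-hand side is negative. *)
Definition beta0_conf (R : realType) (m : nat) : R :=
  let M2 : R := (8 * m - 12)%:R in
  sup [set beta : R | 0 <= beta /\
    let phi1 := tanh (2 * beta) in
    M2 ^+ 2 * phi1 < 1 /\
    exists alpha : R, 0 < alpha < 1 /\
      M2 ^+ 3 * phi1 `^ (1 - alpha)
        / (1 - M2 ^+ 2 * phi1 `^ (1 - alpha)) < 2 * alpha].

(* Main.v *)
(* High temperature expansion. Write t = tanh (2 beta) and u = tanh (2 kappa).
   Expanding both exponentials and summing over the spins turns the expectation
   of W_gamma in a box into u^|gamma| Z_gamma / Z_0, where Z_gamma is the sum
   over the sets P of plaquettes of
     t^|P| prod_(e in the mod 2 boundary of P) (1 / u if e in gamma, else u).
   This weight is multiplicative over components that share no edge. If gamma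
   is part of a large rectangle, an isoperimetric bound shows that the factors
   1 / u cost at most a factor (t' / t)^|P|, for any t' > t; as beta lies below
   the threshold, t < (8 m - 12)^-2 and one can take t' = (8 m - 12)^-2, small
   enough for a lattice animal expansion. By induction, the ratio
   Z_gamma (S + p) / Z_gamma S then depends exponentially little on what gamma
   is far away from p. Now
     rho = Z_gamma1 Z_gamma2 / (Z_gamma Z_0),
   and far from the two points where gamma1 and gamma2 meet the dependences
   cancel. Hence log rho tends to twice the contribution of the neighbourhood of
   one meeting point, in which gamma1 and gamma2 are opposite rays; this depends
   neither on R_n and T_n nor, by symmetry, on the direction. *)
Require Import Defs.
From mathcomp Require Import all_boot all_order all_algebra finmap.
From mathcomp Require Import perm.
From mathcomp Require Import all_classical all_reals all_analysis.
From mathcomp.multinomials Require Import freeg.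
From mathcomp Require Import ring lra zify.
Set Implicit Arguments.
Unset Strict Implicit.
Unset Printing Implicit Defensive.
Import Order.TTheory GRing.Theory Num.Theory.
Import numFieldNormedType.Exports.
Local Open Scope classical_set_scope.
Local Open Scope fset_scope.
Local Open Scope ring_scope.

(** * Polymer partition functions *)

(** The obstacle is small kappa: each edge of gamma in the boundary of P may cost a large factor 1 /
    u, and nothing local compensates it. Control is purely geometric and holds only for rectangles
    whose sides are at least some l depending on beta and kappa; the gap between t and t' is what
    makes such an l exist. Logarithms of partition functions are never expanded into clusters. Only
    the increments ln Z (S + p) - ln Z S are compared, for two edge sets that agree near p. In a
    large box, two balls around the meeting points are filled first, where log rho is known exactly
    by translation; the other plaquettes are then added one at a time, and the errors are summed.
    That sum must be uniform in the box and in n, and here T_n = O(R_n) enters: at many plaquettes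
    near the rectangle the half on the other side is only known to be at distance R_n, so their
    number must be negligible against a decay exponential in R_n. Strict positivity is automatic,
    because it is log rho that converges to a real number. *)

Section Polymer.
Variables (R : realFieldType) (V : choiceType) (adj : rel V).
Hypotheses (adjC : symmetric adj) (adjxx : reflexive adj).

Implicit Types (A B K P Q S : {fset V}) (w : {fset V} -> R).

Definition sep A B := [forall a : A, forall b : B, ~~ adj (val a) (val b)].

Lemma sepP A B :
  reflect (forall a b, a \in A -> b \in B -> ~~ adj a b) (sep A B).
Proof.
apply: (iffP idP) => [/forallP sAB a b aA bB | sAB].
  by have /forallP/(_ [` bB]) := sAB [` aA].
by apply/forallP => a; apply/forallP => b; apply: sAB (valP a) (valP b).
Qed.

Lemma sepC A B : sep A B = sep B A.
Proof.
by apply/sepP/sepP => sAB a b aA bB; rewrite adjC; apply: sAB.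
Qed.

Lemma sepSS A B A' B' : A' `<=` A -> B' `<=` B -> sep A B -> sep A' B'.
Proof.
move=> /fsubsetP sA /fsubsetP sB /sepP sAB.
by apply/sepP => a b /sA aA /sB bB; apply: sAB.
Qed.

Lemma sepUr A B B' : sep A (B `|` B') = sep A B && sep A B'.
Proof.
apply/idP/andP => [sA|[/sepP sB /sepP sB']].
  by split; apply: sepSS sA => //; rewrite (fsubsetUl, fsubsetUr).
by apply/sepP => a b aA; rewrite inE => /orP[]; [exact: sB | exact: sB'].
Qed.

Lemma sep_disjoint A B : sep A B -> [disjoint A & B].
Proof.
move=> /sepP sAB; apply/fdisjointP => a aA; apply/negP => aB.
by have := sAB _ _ aA aB; rewrite adjxx.
Qed.

(* Connectedness without paths: no proper part of [K] containing [p] is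
   isolated from the rest of [K]. *)
Definition conn p K :=
  (p \in K) && [forall A : fpowerset K,
    (p \in val A) && sep (val A) (K `\` val A) ==> (val A == K)].

Lemma connP p K :
  reflect (p \in K /\
           forall A, A `<=` K -> p \in A -> sep A (K `\` A) -> A = K)
          (conn p K).
Proof.
apply: (iffP andP) => -[pK cK]; split => //.
  move=> A AK pA sA; have AP : A \in fpowerset K by rewrite fpowersetE.
  by have /forallP/(_ [` AP])/=/implyP := cK; rewrite pA sA => /(_ isT)/eqP.
apply/forallP => -[A /= AP]; apply/implyP => /andP[pA sA]; apply/eqP.
by apply: cK => //; rewrite -fpowersetE.
Qed.

Lemma conn_mem p K : conn p K -> p \in K. Proof. by case/andP. Qed.

(** Strong induction on [P]: if [P] is not connected, some proper part [A] containing [p] is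
    isolated in [P], and a component isolated in [A] is then isolated in [P]. *)
Lemma component_exists p P : p \in P ->
  exists2 K, conn p K & (K `<=` P) && sep K (P `\` K).
Proof.
elim/finSet_rect: P => P IH pP; case: (boolP (conn p P)) => [cP|/connP ncP].
  by exists P => //; rewrite fsubset_refl; apply/sepP => a b _; rewrite fsetDv inE.
have [A [AP pA sA AnP]] : exists A, [/\ A `<=` P, p \in A, sep A (P `\` A) & A <> P].
  apply: contrapT => nA; apply: ncP; split => // A AP pA sA.
  by apply: contrapT => AnP; apply: nA; exists A; split.
have AltP : A `<` P by rewrite fproperEneq AP andbT; apply/eqP.
have [K cK /andP[KA sK]] := IH A AltP pA; exists K => //.
rewrite (fsubset_trans KA AP) /=; apply/sepP => a b aK.
rewrite inE => /andP[bK bP]; have [bA|bA] := boolP (b \in A).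
  by move/sepP: sK; apply; rewrite // inE bK.
by move/sepP: sA; apply; rewrite ?inE ?bA //; apply: (fsubsetP KA).
Qed.

(** The intersection of [K] and [K'] is isolated in each of them, so connectedness forces inclusion
    both ways. *)
Lemma component_unique p P K K' :
  conn p K -> K `<=` P -> sep K (P `\` K) ->
  conn p K' -> K' `<=` P -> sep K' (P `\` K') -> K = K'.
Proof.
have aux L L' : conn p L -> conn p L' -> L `<=` P -> sep L' (P `\` L') -> L `<=` L'.
  move=> /connP[pL cL] /conn_mem pL' LP /sepP sL'.
  apply/fsetIidPl; apply: cL; rewrite ?fsubsetIl ?inE ?pL //.
  apply/sepP => a b; rewrite !inE => /andP[aL aL'] /andP[bn bL].
  apply: sL' => //; rewrite inE (fsubsetP LP) // andbT.
  by move: bn; rewrite bL.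
move=> cK KP sK cK' KP' sK'; apply/eqP; rewrite eqEfsubset.
by rewrite (aux K K') //= (aux K' K).
Qed.

Definition Z w S := \sum_(P <- fpowerset S) w P.

Lemma in_fset_sep (I : choiceType) (A : {fset I}) (P : pred I) x :
  (x \in [fset y in A | P y]) = (x \in A) && P x.
Proof. by rewrite !inE. Qed.

Lemma fsetDUK (I : choiceType) (A B : {fset I}) : B `<=` A -> A = (A `\` B) `|` B.
Proof.
move=> /fsubsetP BA; apply/fsetP => x; rewrite in_fsetU in_fsetD.
by case: (boolP (x \in B)) => [/BA ->|_]; rewrite ?orbT ?orbF.
Qed.

Lemma big_fsetU_disjoint (I : choiceType) (A B : {fset I}) (F : I -> R) :
  [disjoint A & B] ->
  \sum_(i <- A `|` B) F i = \sum_(i <- A) F i + \sum_(i <- B) F i.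
Proof.
move=> /fdisjointP dAB; rewrite (big_fsetID _ (fun i => i \in A)); congr (_ + _).
  by apply: eq_fbigl => i; rewrite in_fset_sep inE; case: (i \in A) => /=; rewrite ?orbT ?andbF.
apply: eq_fbigl => i; rewrite in_fset_sep inE andb_orl andbN /= andbC.
by have [/dAB/negbTE ->|] := boolP (i \in A).
Qed.

Lemma sum_fpowersetU1 (F : {fset V} -> R) p S : p \notin S ->
  \sum_(P <- fpowerset (p |` S)) F P =
  \sum_(P <- fpowerset S) F P + \sum_(P <- fpowerset S) F (p |` P).
Proof.
move=> pS; have pP P : P \in fpowerset S -> p \notin P.
  by rewrite fpowersetE => /fsubsetP/(_ p) PS; apply: contra pS.
have dS : [disjoint fpowerset S & [fset p |` P | P in fpowerset S]].
  apply/fdisjointP => P /pP; apply: contra => /imfsetP[Q _ ->].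
  by rewrite !inE eqxx.
have -> : fpowerset (p |` S) = fpowerset S `|` [fset p |` P | P in fpowerset S].
  apply/fsetP => P; rewrite in_fsetU !fpowersetE.
  apply/idP/orP => [PS|[PS|]].
  - have [pinP|pnP] := boolP (p \in P); last first.
      left; apply/fsubsetP => x xP; have := fsubsetP PS x xP.
      by rewrite !inE => /orP[/eqP xp|//]; rewrite -xp xP in pnP.
    right; apply/imfsetP; exists (P `\ p); rewrite ?fsetD1K //= fpowersetE.
    by rewrite fsubDset.
  - exact: fsubset_trans PS (fsubsetUr _ _).
  - by move=> /imfsetP[Q /= ]; rewrite fpowersetE => QS ->; rewrite fsetUS.
rewrite big_fsetU_disjoint // [X in _ + X]big_imfset // => P Q /pP pP' /pP pQ' e.
by rewrite -(fsetU1K pP') -(fsetU1K pQ') e.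
Qed.

Lemma sum_fpowersetU (F : {fset V} -> R) A B : [disjoint A & B] ->
  \sum_(P <- fpowerset (A `|` B)) F P =
  \sum_(P <- fpowerset A) \sum_(Q <- fpowerset B) F (P `|` Q).
Proof.
elim/fset1U_rect: A F => [|a A aA IH] F.
  by move=> _; rewrite fset0U fpowerset0 big_seq_fset1; under [RHS]eq_bigr do rewrite fset0U.
rewrite fdisjointU1X => /andP[aB dAB].
rewrite -fsetUA sum_fpowersetU1 ?inE ?negb_or ?aA // sum_fpowersetU1 // !IH //.
by under [X in _ + X]eq_bigr do under eq_bigr do rewrite fsetUA.
Qed.

(** What is left for the other components once the component of a marked cell is fixed to be [K]. *)
Definition cut S K := [fset q in S | sep [fset q] K].

Lemma sep_cut S K Q : Q `<=` cut S K -> sep K Q.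
Proof.
move=> /fsubsetP QS; apply/sepP => a b aK /QS; rewrite !inE /= => /andP[_ /sepP s].
by rewrite adjC; apply: s; rewrite // inE.
Qed.

Record weight (t : R) w : Prop := Weight {
  weight0 : w fset0 = 1;
  weight_ge0 : forall K, 0 <= w K;
  weightU : forall K Q, sep K Q -> w (K `|` Q) = w K * w Q;
  weight_le : forall K, w K <= t ^+ #|` K| }.

Lemma Z_ge1 t w S : weight t w -> 1 <= Z w S.
Proof.
move=> W; rewrite /Z (big_fsetD1 fset0) ?fpowersetE //= (weight0 W) lerDl.
by apply: sumr_ge0 => K _; apply: weight_ge0 W K.
Qed.

Lemma Z_gt0 t w S : weight t w -> 0 < Z w S.
Proof. by move=> W; apply: lt_le_trans (Z_ge1 S W). Qed.

Lemma Z_sub t w S S' : weight t w -> S `<=` S' -> Z w S <= Z w S'.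
Proof.
move=> W SS'; rewrite /Z [leRHS](big_fsetID _ (fun P => P \in fpowerset S)) /=.
rewrite -[leLHS]addr0 lerD //; last by apply: sumr_ge0 => K _; apply: weight_ge0 W K.
rewrite le_eqVlt; apply/orP; left; apply/eqP; apply: eq_fbigl => K; rewrite !inE /= !fpowersetE.
by have [KS|] := boolP (K `<=` S); rewrite ?andbF // (fsubset_trans KS).
Qed.

Lemma ZU t w A B : weight t w -> sep A B -> Z w (A `|` B) = Z w A * Z w B.
Proof.
move=> W sAB; rewrite /Z sum_fpowersetU ?sep_disjoint // big_distrlr /=.
rewrite big_seq [RHS]big_seq; apply: eq_bigr => P; rewrite fpowersetE => PA.
rewrite big_seq [RHS]big_seq; apply: eq_bigr => Q; rewrite fpowersetE => QB.
by rewrite (weightU W) //; apply: sepSS sAB.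
Qed.

(** The sets containing [p] are sorted by the component [K] of [p]. The rest of such a set is an
    arbitrary subset of [cut S K], so summing over it gives a partition function again. *)
Lemma Z_component t w p S : weight t w -> p \notin S ->
  Z w (p |` S) =
  Z w S + \sum_(K <- fpowerset (p |` S) | conn p K) w K * Z w (cut S K).
Proof.
move=> W pS; rewrite /Z (bigID (fun P => p \notin P)) /=; congr (_ + _).
  apply: eq_fbigl_cond => P; rewrite !inE /= !fpowersetE andbT.
  apply/andP/idP => [[/fsubsetP PS pP]|PS]; last first.
    rewrite (fsubset_trans PS (fsubsetUr _ _)); split=> //.
    by apply: contra pS => /(fsubsetP PS).
  apply/fsubsetP => x xP; have := PS x xP; rewrite !inE => /orP[/eqP xp|//].
  by rewrite -xp xP in pP.
pose iso K P := (K `<=` P) && sep K (P `\` K).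
(* The inserted inner sum has exactly one term, by existence and uniqueness of the component. *)
transitivity (\sum_(P <- fpowerset (p |` S) | p \in P)
    \sum_(K <- fpowerset (p |` S) | conn p K && iso K P) w P).
  rewrite big_seq_cond [RHS]big_seq_cond; apply: eq_big => P; first by rewrite negbK.
  rewrite negbK fpowersetE => /andP[PS /component_exists[K cK /andP[KP sK]]].
  rewrite big_mkcond (bigD1_seq K) ?fset_uniq ?fpowersetE ?(fsubset_trans KP) //=.
  rewrite /iso cK KP sK /= big1 ?addr0 // => K' nK'.
  case: ifP => // /andP[cK' /andP[KP' sK']].
  by rewrite (component_unique cK' KP' sK' cK KP sK) eqxx in nK'.
rewrite (exchange_big_dep (conn p)) /=; last by move=> P K _ /andP[].
rewrite big_seq_cond [RHS]big_seq_cond; apply: eq_bigr => K /andP[].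
rewrite fpowersetE => KS cK; rewrite mulr_sumr.
transitivity (\sum_(P <- [fset K `|` Q | Q in fpowerset (cut S K)]) w P).
  rewrite big_fset_condE; apply: eq_fbigl => P; rewrite in_fset_sep fpowersetE.
  rewrite cK /=; apply/andP/imfsetP => [[PS /andP[pP /andP[KP sK]]]|[Q /=]].
    exists (P `\` K); last by rewrite fsetUDl fsetDv fsetD0; apply/esym/fsetUidPr.
    rewrite /= fpowersetE; apply/fsubsetP => x xP; rewrite !inE /=.
    have /andP[xK xP'] : (x \notin K) && (x \in P) by rewrite inE in xP.
    have := fsubsetP PS x xP'; rewrite !inE => /orP[/eqP xp|-> /=].
      by rewrite xp (conn_mem cK) in xK.
    by rewrite sepC; apply: sepSS sK => //; rewrite fsub1set.
  rewrite fpowersetE => QS ->; have sQ := sep_cut QS; rewrite fsubUset KS /=.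
  split; first apply: fsubset_trans (fsubset_trans QS _) (fsubsetUr _ _).
    by apply/fsubsetP => x; rewrite !inE /= => /andP[].
  rewrite inE (conn_mem cK) /iso fsubsetUl /=; apply: sepSS sQ => //.
  by rewrite fsubDset.
rewrite big_imfset /=; last first.
  move=> Q Q'; rewrite !fpowersetE => /sep_cut/sep_disjoint d /sep_cut/sep_disjoint d' e.
  have aux (X : {fset V}) : [disjoint K & X] -> (K `|` X) `\` K = X.
    rewrite fdisjoint_sym => dX; rewrite fsetDUl fsetDv fset0U.
    by apply/fsetDidPl.
  by rewrite -(aux _ d) -(aux _ d') e.
rewrite big_seq [RHS]big_seq; apply: eq_bigr => Q; rewrite fpowersetE => QS.
by rewrite (weightU W) // (sep_cut QS).
Qed.

Definition nbrs S p := [fset q in S | adj p q].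

Lemma mem_nbrs S p q : (q \in nbrs S p) = (q \in S) && adj p q.
Proof. exact: in_fset_sep. Qed.

Lemma nbrs_adj S p q : q \in nbrs S p -> adj p q.
Proof. by rewrite mem_nbrs => /andP[]. Qed.

Variable D : nat.
Hypotheses (D_gt0 : (0 < D)%N) (degD : forall S p, (#|` nbrs S p| <= D)%N).

Lemma card_cut S K : (#|` S `\` cut S K| <= D * #|` K|)%N.
Proof.
elim/fset1U_rect: K => [|k K kK IH].
  rewrite cardfs0 muln0 leqn0 cardfs_eq0; apply/eqP/fsetP => x; rewrite !inE.
  have -> : sep [fset x] fset0 by apply/sepP.
  by case: (x \in S).
rewrite cardfsU1 kK mulnS addnC; have := leq_add IH (degD S k); rewrite addnC.
apply: leq_trans; rewrite [leqRHS]addnC.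
apply: leq_trans (fsubset_leq_card _) (leq_card_fsetU _ _).
apply/fsubsetP => x; rewrite in_fsetU mem_nbrs !(in_fset_sep, in_fsetD) => /andP[].
rewrite negb_and => /[swap] xS; rewrite xS /= andbT => nsx.
case: (boolP (adj k x)) => kx; rewrite ?orbT // orbF.
apply: contra nsx => sx; rewrite sepUr sx andbT.
by apply/sepP => a b; rewrite !inE => /eqP -> /eqP ->; rewrite adjC.
Qed.

Lemma Z_exp (y : R) S : Z (fun P => y ^+ #|` P|) S = (1 + y) ^+ #|` S|.
Proof.
rewrite /Z; elim/fset1U_rect: S => [|p S pS IH].
  by rewrite fpowerset0 big_seq_fset1 cardfs0 !expr0.
rewrite sum_fpowersetU1 // IH cardfsU1 pS exprD expr1 mulrDl mul1r; congr (_ + _).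
rewrite -IH mulr_sumr big_seq [RHS]big_seq; apply: eq_bigr => P.
rewrite fpowersetE => PS; rewrite cardfsU1 (contra (fsubsetP PS p)) //.
by rewrite exprD expr1.
Qed.

Lemma weight_exp (y : R) : 0 <= y -> weight y (fun P => y ^+ #|` P|).
Proof.
move=> y0; split => [|K|K Q sKQ|K]; rewrite ?cardfs0 ?expr0 ?exprn_ge0 //.
by rewrite cardfsU (disjoint_fsetI0 (sep_disjoint sKQ)) cardfs0 subn0 exprD.
Qed.

Lemma exp1D_le2 (y : R) : 0 <= y -> y * D%:R = 2^-1 -> (1 + y) ^+ D <= 2.
(* The linear bound [1 + 2 * k * y] survives the induction as long as [k * y <= 1 / 2], that is, up
   to [k = D]. *)
Proof.
move=> y0 yD; have : forall k, (k <= D)%N -> (1 + y) ^+ k <= 1 + 2 * k%:R * y.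
  elim=> [|k IH] kD; first by rewrite expr0 mulr0 mul0r addr0.
  have kD' : k%:R * y <= 2^-1 by rewrite -yD mulrC ler_wpM2l // ler_nat ltnW.
  rewrite exprSr; apply: le_trans (_ : (1 + 2 * k%:R * y) * (1 + y) <= _).
    by rewrite ler_wpM2r ?IH ?addr_ge0 // ltnW.
  by rewrite -natr1; nra.
by move=> /(_ D (leqnn _)); lra.
Qed.

(** No animal is counted. For the weight [y ^+ #|] P|[with]y = 1 / (2
    D)[the partition function is](1 + y) ^+ #|[S|], so [Z_component] evaluates the sum over
    connected sets exactly. Passing from [cut S K] to [S] costs at most [(1 + y) ^+ (D * #|] K|) <=
    2 ^+ #|[K|], whence the base [y / 2 = 1 / (4 D)]. *)
Lemma animals p S : p \notin S ->
  D%:R * (\sum_(K <- fpowerset (p |` S) | conn p K) (4 * D%:R)^-1 ^+ #|` K|) <= 1 :> R.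
Proof.
move=> pS; have D0 : 0 < D%:R :> R by rewrite ltr0n.
pose y : R := (2 * D%:R)^-1; have y0 : 0 < y by rewrite invr_gt0 mulr_gt0.
have yD : y * D%:R = 2^-1 by rewrite /y; field; rewrite gt_eqF.
have := Z_component (weight_exp (ltW y0)) pS.
rewrite !Z_exp cardfsU1 pS exprD expr1 mulrDl mul1r => /addrI /esym Ek.
have y1 : 0 < 1 + y by rewrite addr_gt0.
set s := \sum_(_ <- _ | _) _.
have : s * (1 + y) ^+ #|` S| <= y * (1 + y) ^+ #|` S|.
  rewrite -Ek mulr_suml; apply: ler_sum => K _; rewrite Z_exp.
  have cS : cut S K `<=` S by apply/fsubsetP => x; rewrite !inE /= => /andP[].
  have -> : #|` S| = (#|` S `\` cut S K| + #|` cut S K|)%N.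
    by rewrite cardfsDS // subnK // fsubset_leq_card.
  rewrite exprD mulrA ler_wpM2r ?exprn_ge0 ?(ltW y1) //.
  have -> : (4 * D%:R)^-1 = y * 2^-1 by rewrite /y; field; rewrite gt_eqF.
  rewrite exprMn -mulrA ler_piMr ?exprn_ge0 ?(ltW y0) //.
  rewrite exprVn mulrC ler_pdivrMr ?exprn_gt0 // mul1r.
  apply: le_trans (_ : (1 + y) ^+ (D * #|` K|) <= _).
    by rewrite ler_weXn2l ?card_cut // lerDl ltW.
  by rewrite exprM lerXn2r ?nnegrE ?exprn_ge0 ?(ltW y1) // exp1D_le2 // ltW.
rewrite ler_pM2r ?exprn_gt0 // => sy.
have := ler_wpM2l (ltW D0) sy; rewrite (mulrC _ y) yD => h.
by apply: le_trans h _; lra.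
Qed.

(** * Exponential decay of the influence of distant weights *)

Variable dist : V -> V -> nat.
Hypotheses (distxx : forall p, dist p p = 0%N)
  (dist_tri : forall p q s, (dist p s <= dist p q + dist q s)%N)
  (dist_adj : forall p q, adj p q -> (dist p q <= 1)%N).

Lemma conn_dist p K k : conn p K -> k \in K -> (dist p k < #|` K|)%N.
Proof.
move=> /connP[pK cK] kK; rewrite ltnNge; apply/negP => Kk.
(* Were a positive distance missed, the points of [K] closer to [p] would be isolated in [K], hence
   all of [K], although [k] is farther. So [K] would realise more distances than it has points. *)
have lev l : (l <= #|` K|)%N -> l \in [seq dist p a | a <- K].
  move=> lK; apply/contraT => nl.
  case: l => [|l] in lK nl *.
    by move/negP: nl; case; apply/mapP; exists p; rewrite ?distxx.
  have := cK [fset a in K | (dist p a <= l)%N].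
  rewrite in_fset_sep distxx pK /= => AK.
  suff e : [fset a in K | (dist p a <= l)%N] = K.
    by have := kK; rewrite -e in_fset_sep kK /=; lia.
  apply: AK => //.
    by apply/fsubsetP => a; rewrite in_fset_sep => /andP[].
  apply/sepP => a b; rewrite in_fsetD !in_fset_sep => /andP[aK al] /andP[].
  rewrite negb_and => /[swap] bK; rewrite bK -ltnNge /= => bl.
  apply/negP => /dist_adj ab; have := dist_tri p a b => tri.
  by move/negP: nl; apply; apply/mapP; exists b => //; lia.
have := @uniq_leq_size _ (iota 0 #|` K|.+1) [seq dist p a | a <- K] (iota_uniq _ _).
rewrite size_iota size_map ltnn => h; suff: false by []; apply: h => l.
by rewrite mem_iota add0n ltnS; exact: lev.
Qed.

Variables (t q : R).
Hypotheses (t_ge0 : 0 <= t) (q_gt0 : 0 < q) (q_le1 : q <= 1)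
  (tq : 8 * D%:R * t <= q).

Definition agree w w' p d :=
  forall K, (forall k, k \in K -> (dist p k <= d)%N) -> w K = w' K.

Lemma agree_ball w w' p f n d :
  (dist p f <= n <= d)%N -> agree w w' p d -> agree w w' f (d - n).
Proof.
by move=> pf A K hK; apply: A => k /hK; have := dist_tri p f k; lia.
Qed.

(** Removes [F] point by point. The one-point ratios are at least 1, so inverting them does not
    increase their difference, and the accumulated ratios lie in [[0, 1]]; the errors therefore just
    add up. The third hypothesis is the induction hypothesis of [decay]. *)
Lemma ratio_set w w' e S F : weight t w -> weight t w' ->
  (forall S p, p \notin S -> agree w w' p e ->
    `|Z w (p |` S) / Z w S - Z w' (p |` S) / Z w' S| <= q ^+ e) ->
  F `<=` S -> (forall f, f \in F -> agree w w' f e) ->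
  `|Z w (S `\` F) / Z w S - Z w' (S `\` F) / Z w' S| <= #|` F|%:R * q ^+ e.
Proof.
move=> W W' step; elim/fset1U_rect: F => [|f F fF IH] FS hF.
  by rewrite fsetD0 !divff ?gt_eqF ?(Z_gt0 _ W, Z_gt0 _ W') // subrr normr0 cardfs0 mul0r.
have /andP[fS FS'] : (f \in S) && (F `<=` S) by rewrite -fsub1set -fsubUset.
have {}IH := IH FS' (fun g gF => hF g (fset1Ur _ gF)).
have fSF : f \notin (S `\` F) `\ f by rewrite !inE eqxx.
have := step _ f fSF (hF f (fset1U1 _ _)).
have -> : f |` ((S `\` F) `\ f) = S `\` F by rewrite fsetD1K // inE fF.
have -> : S `\` (f |` F) = (S `\` F) `\ f.
  by apply/fsetP => x; rewrite !inE negb_or andbA.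
rewrite cardfsU1 fF natrD mulrDl mul1r.
have fr v : weight t v ->
    [/\ 1 <= Z v (S `\` F) / Z v ((S `\` F) `\ f),
      0 <= Z v (S `\` F) / Z v S <= 1 &
      Z v ((S `\` F) `\ f) / Z v S =
      (Z v (S `\` F) / Z v ((S `\` F) `\ f))^-1 * (Z v (S `\` F) / Z v S)].
  move=> Wv; have p1 := Z_gt0 (S `\` F) Wv; have p2 := Z_gt0 ((S `\` F) `\ f) Wv.
  have p3 := Z_gt0 S Wv; split.
  - by rewrite ler_pdivlMr // mul1r (Z_sub Wv) // fsubsetDl.
  - by rewrite divr_ge0 ?(ltW p1) ?(ltW p3) // ler_pdivrMr // mul1r (Z_sub Wv) // fsubsetDl.
  - by field; rewrite !gt_eqF.
have [r1 /andP[s0 s1] ->] := fr _ W; have [r1' /andP[s0' s1'] ->] := fr _ W'.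
move: r1 s0 s1 r1' s0' s1' IH.
move: (Z w _ / Z w _) (Z w _ / Z w _) (Z w' _ / Z w' _) (Z w' _ / Z w' _).
move=> s r s' r' r1 s0 s1 r1' s0' s1' IH rr.
have rV : `|r^-1 - r'^-1| <= q ^+ e.
  have r0 : 0 < r by lra.
  have r0' : 0 < r' by lra.
  have -> : r^-1 - r'^-1 = (r' - r) / (r * r') by field; rewrite !gt_eqF.
  rewrite normrM normfV distrC ler_pdivrMr; last first.
    by rewrite normr_gt0 mulf_neq0 ?gt_eqF.
  apply: le_trans rr _; rewrite ler_peMr ?exprn_ge0 ?(ltW q_gt0) //.
  by rewrite normrM !gtr0_norm // mulr_ege1.
have -> : r^-1 * s - r'^-1 * s' = (r^-1 - r'^-1) * s + r'^-1 * (s - s') by ring.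
apply: le_trans (ler_normD _ _) _; rewrite !normrM lerD //.
  by apply: le_trans rV; rewrite ler_piMr // ger0_norm.
apply: le_trans IH; rewrite ler_piMl // ger0_norm ?invr_ge0; last by lra.
by rewrite invf_le1; lra.
Qed.

(** Strong induction on [d] through [Z_component]. A component [K] of size [n <= d] lies in the ball
    where the weights agree, and it removes at most [n * D] cells, all within distance [n] of [p],
    where agreement to depth [d - n] is left. A larger component is paid for by its own weight. *)
Lemma decay w w' d S p : weight t w -> weight t w' -> p \notin S ->
  agree w w' p d ->
  `|Z w (p |` S) / Z w S - Z w' (p |` S) / Z w' S| <= q ^+ d.
Proof.
move=> W W'; elim/ltn_ind: d S p => d IH S p pS A.
have ratioE v : weight t v -> Z v (p |` S) / Z v S =
    1 + \sum_(K <- fpowerset (p |` S) | conn p K) v K * (Z v (cut S K) / Z v S).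
  move=> Wv; rewrite (Z_component Wv pS) mulrDl divff ?gt_eqF ?(Z_gt0 _ Wv) //.
  by congr (_ + _); rewrite mulr_suml; apply: eq_bigr => K _; rewrite mulrA.
rewrite !ratioE // opprD addrACA subrr add0r -sumrB.
apply: le_trans (ler_norm_sum _ _ _) _.
have cS K : cut S K `<=` S by apply/fsubsetP => x; rewrite in_fset_sep => /andP[].
have cutr v K : weight t v -> 0 <= Z v (cut S K) / Z v S <= 1.
  move=> Wv; have p3 := Z_gt0 S Wv; have p2 := Z_gt0 (cut S K) Wv.
  by rewrite divr_ge0 ?(ltW p2) ?(ltW p3) // ler_pdivrMr // mul1r (Z_sub Wv).
apply: le_trans (_ : q ^+ d * (D%:R *
   \sum_(K <- fpowerset (p |` S) | conn p K) (4 * D%:R)^-1 ^+ #|` K|) <= _); last first.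
  by rewrite ler_piMr ?exprn_ge0 ?(ltW q_gt0) // animals.
rewrite mulrA mulr_sumr; apply: ler_sum => K cK.
set n := #|` K|; have D0 : 0 < D%:R :> R by rewrite ltr0n.
have n0 : (0 < n)%N by rewrite /n cardfs_gt0; apply/fset0Pn; exists p; exact: conn_mem.
(* The 8 in [8 * D * t <= q] is 2 times 4: [2 ^+ n] absorbs the factor [n], and [4 * D] is the base
   in [animals]. *)
have tn : t ^+ n * (n%:R * D%:R) <= q ^+ n * D%:R * (4 * D%:R)^-1 ^+ n.
  have n2 : n%:R <= 2 ^+ n :> R by rewrite -natrX ler_nat ltnW // ltn_expl.
  rewrite mulrA [leRHS]mulrAC ler_wpM2r ?(ltW D0) //.
  apply: le_trans (_ : (2 * t) ^+ n <= _).
    by rewrite exprMn mulrC ler_wpM2r ?exprn_ge0.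
  rewrite -exprMn lerXn2r ?nnegrE ?mulr_ge0 ?invr_ge0 ?mulr_ge0 ?(ltW q_gt0) ?(ltW D0) //.
  by rewrite ler_pdivlMr ?mulr_gt0 //; apply: le_trans tq; lra.
have [nd|dn] := leqP n d.
  have qd : q ^+ d = q ^+ (d - n) * q ^+ n by rewrite -exprD subnK.
  have -> : w K = w' K.
    by apply: A => k kK; have := conn_dist cK kK; lia.
  rewrite -mulrBr normrM ger0_norm ?(weight_ge0 W') //.
  apply: le_trans (_ : t ^+ n * ((n * D)%N%:R * q ^+ (d - n)) <= _); last first.
    rewrite qd natrM; have := ler_wpM2l (exprn_ge0 (d - n) (ltW q_gt0)) tn.
    by move=> h; rewrite mulrA [leLHS]mulrC -!mulrA; rewrite -!mulrA in h.
  apply: ler_pM; rewrite ?(weight_ge0 W') ?(weight_le W') //.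
  have -> : cut S K = S `\` (S `\` cut S K) by rewrite fsetDK.
  apply: le_trans (ratio_set (e := (d - n)%N) W W' _ _ _) _; rewrite ?fsubsetDl //.
  - by move=> S' p' pS' A'; apply: IH A' => //; rewrite ltn_subrL n0 (leq_trans n0).
  - move=> f; rewrite in_fsetD in_fset_sep => /andP[nf fS].
    apply: agree_ball A; rewrite nd andbT.
    move: nf; rewrite fS /= => /forallPn[a /forallPn[b]].
    have := valP a; rewrite inE => /eqP ->; rewrite negbK adjC => /dist_adj bf.
    apply: leq_trans (dist_tri p (val b) f) _.
    apply: leq_trans (leq_add (leqnn _) bf) _; rewrite addn1.
    exact: conn_dist cK (valP b).
  - by rewrite ler_wpM2r ?exprn_ge0 ?(ltW q_gt0) // ler_nat mulnC card_cut.
(* Here [K] may leave the ball; both terms lie between 0 and [t ^+ n] with [n > d]. *)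
apply: le_trans (_ : t ^+ n <= _).
  have [/andP[a0 a1] /andP[b0 b1]] := (cutr _ K W, cutr _ K W').
  have := (weight_ge0 W K, weight_ge0 W' K, weight_le W K, weight_le W' K).
  move=> [[[w0 w0'] w1] w1']; rewrite ler_norml; apply/andP; split; nra.
apply: le_trans (_ : t ^+ n * (n%:R * D%:R) <= _).
  by rewrite ler_peMr ?exprn_ge0 // -natrM ler1n muln_gt0 n0.
apply: le_trans tn _; rewrite -!mulrA ler_wpM2r //.
by rewrite ler_wiXn2l ?(ltW q_gt0) ?(ltnW dn).
Qed.

(** Serves when the two weights already differ next to [p], too close for [decay]. *)
Lemma ratio_le2 w S p : weight t w -> p \notin S -> Z w (p |` S) / Z w S <= 2.
Proof.
move=> W pS; have Z0 := Z_gt0 S W; rewrite ler_pdivrMr // (Z_component W pS).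
rewrite mulrDl mul1r lerD2l.
have D0 : 1 <= D%:R :> R by rewrite ler1n.
apply: le_trans (_ : (\sum_(K <- fpowerset (p |` S) | conn p K)
    (4 * D%:R)^-1 ^+ #|` K|) * Z w S <= _).
  rewrite mulr_suml; apply: ler_sum => K _; apply: ler_pM.
  - exact: weight_ge0 W K.
  - exact: ltW (Z_gt0 _ W).
  - apply: le_trans (weight_le W K) _.
    rewrite lerXn2r ?nnegrE ?invr_ge0 ?mulr_ge0 //.
    rewrite -[leRHS]mul1r ler_pdivlMr; last by lra.
    by have := tq; have := q_le1; nra.
  - by apply: Z_sub W _; apply/fsubsetP => x; rewrite in_fset_sep => /andP[].
rewrite ler_piMl ?(ltW Z0) //; apply: le_trans _ (animals pS).
by rewrite ler_peMl ?sumr_ge0 // => K _; rewrite exprn_ge0 ?invr_ge0 ?mulr_ge0.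
Qed.

End Polymer.

Lemma sum_fpowerset_imfset (R : realFieldType) (V V' : choiceType) (f : V -> V')
    (F : {fset V'} -> R) (S : {fset V}) : injective f ->
  \sum_(P <- fpowerset [fset f x | x in S]) F P =
  \sum_(P <- fpowerset S) F [fset f x | x in P].
Proof.
move=> fI; elim/fset1U_rect: S F => [|p S pS IH] F.
  by rewrite imfset0 !fpowerset0 !big_seq_fset1 imfset0.
have nf : f p \notin [fset f x | x in S].
  by apply: contra pS => /imfsetP[x /= xS /fI ->].
rewrite imfsetU1 !sum_fpowersetU1 // !IH; congr (_ + _).
by apply: eq_bigr => P _; rewrite imfsetU1.
Qed.

(** * Plaquettes, boundaries and the isoperimetric bound *)

Section Lattice.
Variable m : nat.
Implicit Types (p q : pplaq m) (e : pedge m) (K Q S : {fset pplaq m}).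

Lemma unitvE (i k : 'I_m) : unitv i 0 k = (k == i)%:R.
Proof. by rewrite /unitv mxE eqxx. Qed.

(** Orientation is dropped, since only boundaries mod 2 occur. A triple whose directions are not
    increasing is no plaquette; it has no edges and is adjacent to itself only. *)
Definition edges p : seq (pedge m) :=
  if (p.1.2 < p.2)%N then
    [:: (p.1.1, p.1.2); (p.1.1 + unitv p.1.2, p.2);
        (p.1.1 + unitv p.2, p.1.2); (p.1.1, p.2)]
  else [::].

Definition adj : rel (pplaq m) :=
  fun p q => (p == q) || has (mem (edges q)) (edges p).

Lemma adjC : symmetric adj.
Proof. by move=> p q; rewrite /adj eq_sym has_sym. Qed.

Lemma adjxx : reflexive adj. Proof. by move=> p; rewrite /adj eqxx. Qed.

Lemma adjP p q : adj p q -> p = q \/ exists e, (e \in edges p) && (e \in edges q).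
Proof.
case/orP => [/eqP|/hasP[e ep eq]]; first by left.
by right; exists e; rewrite ep.
Qed.

Lemma unitv_neq0 (i : 'I_m) : unitv i != 0.
Proof. by apply/eqP => /matrixP/(_ 0 i); rewrite unitvE mxE eqxx. Qed.

Lemma edges_uniq p : uniq (edges p).
Proof.
rewrite /edges; case: ifP => // ab.
have nab : p.1.2 != p.2 by rewrite neq_ltn ab.
have xD i : (p.1.1 + unitv i == p.1.1) = false.
  by rewrite -subr_eq0 addrAC subrr add0r; apply/negbTE/unitv_neq0.
by rewrite /= !inE !xpair_eqE !(eq_sym p.1.1) !(eq_sym p.2) (negbTE nab) !xD !andbF.
Qed.

Lemma sum_edges p (F : pedge m -> nat) : (p.1.2 < p.2)%N ->
  (\sum_(e <- edges p) F e =
  F (p.1.1, p.1.2) + F ((p.1.1 + unitv p.1.2)%R, p.2) +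
  F ((p.1.1 + unitv p.2)%R, p.1.2) + F (p.1.1, p.2))%N.
Proof. by rewrite /edges => ->; rewrite !big_cons big_nil addn0 !addnA. Qed.

Lemma edge_base p e : e \in edges p ->
  forall k, p.1.1 0 k <= e.1 0 k <= p.1.1 0 k + 1.
Proof.
rewrite /edges; case: ifP => // _ h k.
have b (c : bool) : 0 <= (c%:R : int) <= 1 by case: c.
move: h; rewrite !inE => /or4P[] /eqP -> /=; rewrite ?mxE ?lexx ?lerDl ?lerD2l //.
Qed.

Definition nrm (x : 'rV[int]_m) : nat := \max_(k < m) absz (x 0%R k).

Lemma nrm_le (x : 'rV[int]_m) d : (nrm x <= d)%N = [forall k, (absz (x 0%R k) <= d)%N].
Proof.
apply/bigmax_leqP/forallP => h k; [exact: h|move=> _; exact: h].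
Qed.

Lemma nrmP (x : 'rV[int]_m) d : reflect (forall k, (absz (x 0%R k) <= d)%N) (nrm x <= d)%N.
Proof. by rewrite nrm_le; apply: forallP. Qed.

Lemma nrm_coord (x : 'rV[int]_m) k : (absz (x 0%R k) <= nrm x)%N.
Proof. by move: k; apply/nrmP. Qed.

Lemma nrmN (x : 'rV[int]_m) : nrm (- x) = nrm x.
Proof. by apply: eq_bigr => k _; rewrite mxE abszN. Qed.

Lemma nrmD (x y : 'rV[int]_m) : (nrm (x + y) <= nrm x + nrm y)%N.
Proof.
apply/nrmP => k; have := nrm_coord x k; have := nrm_coord y k; rewrite mxE.
by move: (x 0 k) (y 0 k) (nrm x) (nrm y); lia.
Qed.

Lemma nrm_unitvn (i : 'I_m) n : (nrm (unitv i *+ n) <= n)%N.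
Proof.
apply/nrmP => k; rewrite mulmxnE unitvE.
by case: (k == i); rewrite ?mul0rn ?natz //= absz_nat.
Qed.

Definition pdist p q : nat := nrm (q.1.1 - p.1.1).

Lemma pdistxx p : pdist p p = 0%N.
Proof.
by apply/eqP; rewrite -leqn0; apply/nrmP => k; rewrite subrr mxE.
Qed.

Lemma pdist_tri p q s : (pdist p s <= pdist p q + pdist q s)%N.
Proof.
apply/nrmP => k; have := nrm_coord (q.1.1 - p.1.1) k.
have := nrm_coord (s.1.1 - q.1.1) k; rewrite /pdist !mxE.
by move: (p.1.1 _ _) (q.1.1 _ _) (s.1.1 _ _) (nrm _) (nrm _); lia.
Qed.

Lemma pdist_adj p q : adj p q -> (pdist p q <= 1)%N.
Proof.
case/adjP => [->|[e /andP[ep eq]]]; first by rewrite pdistxx.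
apply/nrmP => k; have := edge_base ep k; have := edge_base eq k.
by rewrite !mxE; move: (p.1.1 _ _) (q.1.1 _ _) (e.1 _ _); lia.
Qed.

Definition star e : seq (pplaq m) :=
  [seq (let y := if s then e.1 else e.1 - unitv l in
        if (e.2 < l)%N then (y, e.2, l) else (y, l, e.2))
     | l <- [seq l <- enum 'I_m | l != e.2], s <- [:: true; false]].

Lemma size_star e : size (star e) = (2 * m.-1)%N.
Proof.
rewrite size_allpairs mulnC; congr (_ * _)%N.
rewrite -rem_filter ?enum_uniq // size_rem ?mem_enum //.
by rewrite -cardE card_ord.
Qed.

Lemma mem_star p e : e \in edges p -> p \in star e.
Proof.
rewrite /edges; case: ifP => // ab.
case: p ab => [[x a] b] /= ab; rewrite !inE.
have nab : a != b by rewrite neq_ltn ab.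
have abF : (b < a)%N = false by rewrite ltnNge ltnW.
case/or4P => /eqP ->; apply/allpairsP.
- by exists (b, true); rewrite /= mem_filter mem_enum eq_sym nab ab.
- by exists (a, false); rewrite /= mem_filter mem_enum nab abF addrK.
- by exists (b, false); rewrite /= mem_filter mem_enum eq_sym nab ab addrK.
- by exists (a, true); rewrite /= mem_filter mem_enum nab abF.
Qed.

(** Four edges, each in [2 * (m - 1)] plaquettes; [p] itself is already counted in the star of its
    first edge. *)
Lemma card_adj S p : (1 < m)%N -> (#|` nbrs adj S p| <= 8 * m.-1)%N.
Proof.
move=> m1; have [ab|nab] := boolP (p.1.2 < p.2)%N; last first.
  apply: (@leq_trans #|` [fset p]|); last by rewrite cardfs1; lia.
  apply: fsubset_leq_card.
  apply/fsubsetP => q.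
  case/nbrs_adj/adjP=> [->|[e]]; first by rewrite inE.
  by rewrite /edges (negbTE nab) inE.
pose s := flatten [seq star e | e <- edges p].
apply: (@leq_trans #|` seq_fset tt s|).
  apply: fsubset_leq_card; apply/fsubsetP => q; rewrite seq_fsetE.
  case/nbrs_adj/adjP=> [<-|[e /andP[ep eq]]]; apply/flatten_mapP.
    have ep : (p.1.1, p.1.2) \in edges p by rewrite /edges ab !inE eqxx.
    by exists (p.1.1, p.1.2) => //; apply: mem_star.
  by exists e => //; apply: mem_star.
rewrite size_seq_fset; apply: leq_trans (size_undup _) _.
rewrite size_flatten /shape -map_comp sumnE big_map.
under eq_bigr do rewrite /= size_star.
rewrite (sum_edges _ ab); lia.
Qed.

Definition bd K e : bool := odd (\sum_(p <- K) (e \in edges p)).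

Definition bdy K : {fset pedge m} :=
  [fset e in seq_fset tt (flatten [seq edges p | p <- K]) | bd K e].

Lemma mem_bdy K e : (e \in bdy K) = bd K e.
Proof.
rewrite in_fset_sep seq_fsetE; case: (boolP (bd K e)); rewrite ?andbF // andbT => h.
apply/flatten_mapP; apply: contrapT => nh; move: h; rewrite /bd big_seq big1 //.
by move=> p pK; apply/eqP; rewrite eqb0; apply/negP => ep; apply: nh; exists p.
Qed.

Lemma bdU K Q e : [disjoint K & Q]%fset -> bd (K `|` Q) e = bd K e (+) bd Q e.
Proof.
move=> d; rewrite /bd -oddD; congr odd.
rewrite (big_fsetID _ (fun p => p \in K)); congr (_ + _)%N; apply: eq_fbigl => p.
  by rewrite in_fset_sep inE; case: (p \in K); rewrite ?orbT ?andbF.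
rewrite in_fset_sep inE andbC; case: (boolP (p \in K)) => //= pK.
by have /fdisjointP/(_ p pK)/negbTE := d.
Qed.

Lemma bd_supp K e : bd K e -> exists2 p, p \in K & e \in edges p.
Proof.
move=> h; apply: contrapT => nh; move: h; rewrite /bd big_seq big1 //.
by move=> p pK; apply/eqP; rewrite eqb0; apply/negP => ep; apply: nh; exists p.
Qed.

(** Stokes mod 2: pairing [H] with the boundary of [K] is pairing the coboundary of [H] with [K]. *)
Lemma odd_bdy K (H : pred (pedge m)) :
  odd (\sum_(e <- bdy K) H e) = odd (\sum_(p <- K) \sum_(e <- edges p) H e).
Proof.
set E := seq_fset tt (flatten [seq edges p | p <- K]).
have -> : odd (\sum_(e <- bdy K) H e) = odd (\sum_(e <- E) bd K e * H e).
  congr odd; rewrite /bdy -/E -big_fset_condE [LHS]big_mkcond /=.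
  by apply: eq_bigr => e _; case: (bd K e); rewrite ?mul1n.
rewrite (big_morph odd oddD (erefl _)).
transitivity (\big[addb/false]_(e <- E) odd (\sum_(p <- K) (e \in edges p) * H e)).
  by apply: eq_bigr => e _; rewrite -big_distrl /= !oddM oddb.
rewrite -(big_morph odd oddD (erefl false : odd 0 = false)) exchange_big /=; congr odd.
rewrite big_seq [RHS]big_seq; apply: eq_bigr => p pK.
rewrite (eq_bigr (fun e => if e \in edges p then H e : nat else 0%N)); last first.
  by move=> e _; case: (e \in edges p); rewrite ?mul1n.
rewrite -big_mkcond -big_filter; apply: perm_big.
apply: uniq_perm; [by apply: filter_uniq; apply: (fset_uniq E) | exact: edges_uniq |] => e.
rewrite mem_filter; case: (boolP (e \in edges p)) => //= ep.
by rewrite -[e \in _]/(e \in E) seq_fsetE; apply/flatten_mapP; exists p.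
Qed.

(** The exponent of [1 / u] that a boundary edge contributes to the weight. *)
Definition gain (G : pred (pedge m)) e : int := if G e then 1 else -1.

(** As [H] holds at most one edge of [G], the gain inside [H] is at most 1, and it is positive only
    if [e0] is the only boundary edge in [H]; that number being odd, [c] is then positive. *)
Lemma gain_le K (G H : pred (pedge m)) e0 (c : nat) :
  (forall e, H e -> G e -> e = e0) ->
  (odd (\sum_(e <- bdy K) H e) -> (0 < c)%N) ->
  \sum_(e <- bdy K | H e) gain G e <= c%:Z.
Proof.
move=> HG odc.
have gN e : H e -> e != e0 -> gain G e = -1.
  by move=> He ne; rewrite /gain; case: ifP => // /(HG _ He) ee; rewrite ee eqxx in ne.
have [/andP[eK He]|nin] := boolP ((e0 \in bdy K) && H e0); last first.
  rewrite big_seq_cond (@le_trans _ _ 0) // sumr_le0 // => e /andP[eK He].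
  by rewrite gN //; apply: contra nin => /eqP <-; rewrite eK.
rewrite (big_fsetD1 e0) // He in odc; rewrite big_mkcond (big_fsetD1 e0) //= He.
have -> : \sum_(e <- bdy K `\ e0) (if H e then gain G e else 0) =
    - (\sum_(e <- bdy K `\ e0) H e)%N%:Z.
  rewrite (big_morph Posz PoszD (erefl 0 : Posz 0 = 0)) -sumrN big_seq [RHS]big_seq.
  apply: eq_bigr => e; rewrite !inE => /andP[ne _].
  by case: (boolP (H e)) => [He'|_]; rewrite ?gN ?oppr0.
have : gain G e0 <= 1 by rewrite /gain; case: ifP.
by move: odc; case: (\sum_(_ <- _) _)%N => [|n] /=; lia.
Qed.

(** * Slabs, crossing plaquettes and the isoperimetric bound *)

Section Rectangle.
Variables (i j : 'I_m) (T L : nat).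
Hypothesis ij : i != j.

Definition sides (i j : 'I_m) (T L : nat) : pred (pedge m) := fun e =>
  (e.2 == j) && [exists y : 'I_L,
    (e.1 == unitv j *+ y) || (e.1 == unitv i *+ T + unitv j *+ y)].

Definition crossing (i j : 'I_m) (a y : nat) : pred (pplaq m) := fun p =>
  [&& (p.1.2 < p.2)%N, p.1.1 0 i == a, p.1.1 0 j == y &
      (p.1.2 == i) && (p.2 == j) || (p.1.2 == j) && (p.2 == i)].

(** A plaquette has no or two edges of direction [j] at height [y]. Exactly one of them lies on a
    given side of the cut between [a] and [a + 1] only if the plaquette spans this cut. *)
Lemma odd_slab a y p (H : pred (pedge m)) :
  (forall e, H e = [&& e.2 == j, e.1 0 j == y%:Z & e.1 0 i <= a%:Z]) \/
  (forall e, H e = [&& e.2 == j, e.1 0 j == y%:Z & a%:Z < e.1 0 i]) ->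
  odd (\sum_(e <- edges p) H e) -> crossing i j a y p.
Proof.
move=> hH; have [ab|nab] := boolP (p.1.2 < p.2)%N; last first.
  by rewrite /edges (negbTE nab) big_nil.
rewrite sum_edges // /crossing ab /=.
case: p ab => [[x a'] b] /= ab.
have nab : a' != b by rewrite neq_ltn ab.
case: hH => hH; rewrite !hH /= !mxE !eqxx /=; move: (x 0 i) (x 0 j) => xi xj.
- have [aj|naj] := eqVneq a' j; have [bj|nbj] := eqVneq b j.
  + by rewrite aj bj eqxx in nab.
  + rewrite aj (negbTE ij) (eq_sym i b).
    by case: (eqVneq b i) => _ /=; rewrite ?addr0 ?andbF; lia.
  + rewrite bj (negbTE ij) (eq_sym i a').
    by case: (eqVneq a' i) => _ /=; rewrite ?addr0 ?andbF; lia.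
  + by [].
- have [aj|naj] := eqVneq a' j; have [bj|nbj] := eqVneq b j.
  + by rewrite aj bj eqxx in nab.
  + rewrite aj (negbTE ij) (eq_sym i b).
    by case: (eqVneq b i) => _ /=; rewrite ?addr0 ?andbF; lia.
  + rewrite bj (negbTE ij) (eq_sym i a').
    by case: (eqVneq a' i) => _ /=; rewrite ?addr0 ?andbF; lia.
  + by [].
Qed.

Lemma unitvnE (k l : 'I_m) n : (unitv k *+ n) 0 l = ((l == k) * n)%N%:Z.
Proof. by rewrite mulmxnE unitvE; case: (l == k); rewrite ?mul1n ?mul0n ?mul0rn ?natz. Qed.

Lemma odd_sum_exists K (c : pred (pplaq m)) (F : pplaq m -> nat) :
  (forall p, odd (F p) -> c p) -> odd (\sum_(p <- K) F p) ->
  (0 < \sum_(p <- K) c p)%N.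
Proof.
move=> Fc; rewrite (big_morph odd oddD (erefl _)) => h.
have [p pK Fp] : exists2 p, p \in K & odd (F p).
  apply: contrapT => nh; move: h; rewrite big_seq big1 // => p pK.
  by apply/negP => Fp; apply: nh; exists p.
by rewrite (big_fsetD1 p) //= (Fc _ Fp).
Qed.

(** For [a < T] the cut after column [a] separates the two edges of [G] in the slab, so each
    half-slab falls under [gain_le]; a positive gain forces, by parity, a plaquette of [K] across
    the cut. The two halves give the factor 2. *)
Lemma slab_gain K (G : pred (pedge m)) a y :
  (forall e, G e -> e.2 == j -> sides i j T L e) -> (a < T)%N ->
  \sum_(e <- bdy K | (e.2 == j) && (e.1 0 j == y%:Z)) gain G e <=
  (2 * \sum_(p <- K) crossing i j a y p)%N%:Z.
Proof.
move=> hG aT; rewrite (bigID (fun e => e.1 0 i <= a%:Z)) /=.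
rewrite mul2n -addnn PoszD; apply: lerD.
- apply: (gain_le (e0 := (unitv j *+ y, j))) => [[x k] /=|].
    case/andP=> /andP[/eqP -> /eqP xj] xi /hG/=; rewrite eqxx /sides eqxx /= => /(_ isT).
    case/existsP => y' /orP[]/eqP xE; move: xj xi; rewrite xE ?mxE !unitvnE !eqxx /=.
      by rewrite !mul1n => -[<-].
    by rewrite (negbTE ij); lia.
  rewrite odd_bdy; apply: odd_sum_exists => p; apply: odd_slab; left => e.
  by rewrite andbA.
- apply: (gain_le (e0 := (unitv i *+ T + unitv j *+ y, j))) => [[x k] /=|].
    case/andP=> /andP[/eqP -> /eqP xj] xi /hG/=; rewrite eqxx /sides eqxx /= => /(_ isT).
    case/existsP => y' /orP[]/eqP xE; move: xj xi; rewrite xE ?mxE !unitvnE !eqxx /=.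
      by rewrite (negbTE ij); lia.
    by rewrite eq_sym (negbTE ij) !mul1n mul0n add0r => -[<-].
  rewrite odd_bdy; apply: odd_sum_exists => p; apply: odd_slab; right => e.
  by rewrite andbA -ltNge.
Qed.

Lemma sum_crossing K A B :
  (\sum_(y < B) \sum_(a < A) \sum_(p <- K) crossing i j a y p <= #|` K|)%N.
Proof.
under eq_bigr do rewrite exchange_big /=.
rewrite exchange_big /= -(sum1_size (enum_fset K)).
apply: leq_sum => p _.
case: (boolP [exists y : 'I_B, exists a : 'I_A, crossing i j a y p]); last first.
  move=> /existsPn h; rewrite big1 // => y _; rewrite big1 // => a _.
  by have /existsPn/(_ a)/negbTE -> := h y.
case/existsP => y /existsP[a cay].
rewrite (bigD1 y) //= (bigD1 a) //= cay !big1 // => [y' ny|a' na]; last first.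
  apply/eqP; rewrite eqb0; apply/negP => /and4P[_ /eqP pa _ _].
  move: cay; rewrite /crossing pa => /and4P[_ /eqP[aa] _ _].
  by case/negP: na; apply/eqP/val_inj.
rewrite big1 // => a' _; apply/eqP; rewrite eqb0; apply/negP => /and4P[_ _ /eqP pa _].
move: cay; rewrite /crossing pa => /and4P[_ _ /eqP[aa] _].
by case/negP: ny; apply/eqP/val_inj.
Qed.

(** Sums [slab_gain] over [l] different cuts [a]. The left side does not depend on [a], while a
    plaquette crosses for at most one pair [(a, y)]. *)
Lemma slabs_gain K (G : pred (pedge m)) l :
  (forall e, G e -> e.2 == j -> sides i j T L e) -> (l <= T)%N ->
  l%:Z * (\sum_(y < L) \sum_(e <- bdy K | (e.2 == j) && (e.1 0 j == y%:Z)) gain G e)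
  <= (2 * #|` K|)%N%:Z.
Proof.
move=> hG lT; apply: (@le_trans _ _
   (2 * \sum_(y < L) \sum_(a < l) \sum_(p <- K) crossing i j a y p)%N%:Z); last first.
  by rewrite lez_nat leq_mul2l sum_crossing orbT.
rewrite mulr_sumr [X in _ <= Posz X]big_distrr /= (big_morph Posz PoszD (erefl 0 : Posz 0 = 0)).
apply: ler_sum => y _.
rewrite [X in _ <= Posz X]big_distrr /= (big_morph Posz PoszD (erefl 0 : Posz 0 = 0)).
rewrite -[l%:Z]natz mulr_natl -[X in _ *+ X <= _]card_ord -sumr_const.
by apply: ler_sum => a _; apply: slab_gain => //; apply: leq_trans lT.
Qed.
End Rectangle.

(* Each slab orthogonal to a side of the rectangle meets the rectangle in two
   edges, and [bdy K] meets it evenly. Cancelling both edges without creating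
   another one therefore needs a sheet of plaquettes of [K] joining them inside
   the slab. *)
Lemma rectangle_gain (i j : 'I_m) (T L l : nat) K (G : pred (pedge m)) :
  i != j -> (l <= T)%N -> (l <= L)%N ->
  (forall e, G e -> sides i j T L e || sides j i L T e) ->
  l%:Z * (\sum_(e <- bdy K) gain G e) <= (4 * #|` K|)%N%:Z.
Proof.
move=> ij lT lL hG.
have ji : j != i by rewrite eq_sym.
have hj e : G e -> e.2 == j -> sides i j T L e.
  by move=> /hG /orP[//|]; rewrite /sides => /andP[/eqP -> _]; rewrite (negbTE ij).
have hi e : G e -> e.2 == i -> sides j i L T e.
  by move=> /hG /orP[|//]; rewrite /sides => /andP[/eqP -> _]; rewrite (negbTE ji).
have := lerD (slabs_gain ij K hj lT) (slabs_gain ji K hi lL).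
rewrite -mulrDr -PoszD -mulnDl; apply: le_trans.
apply: ler_wpM2l => //.
pose s k (n : nat) e := (e.2 == k) && (e.1 0 k == n%:Z).
have slabE k n e : s k n e -> forall n', s k n' e = (n' == n).
  move=> /andP[ek /eqP en] n'; rewrite /s ek en /=.
  by apply/eqP/eqP => [[->]|->].
have big k M : \sum_(y < M) \sum_(e <- bdy K | s k y e) gain G e =
    \sum_(e <- bdy K) if [exists y : 'I_M, s k y e] then gain G e else 0.
  under eq_bigr do rewrite big_mkcond.
  rewrite exchange_big /=; apply: eq_bigr => e _.
  case: (boolP [exists y : 'I_M, s k y e]) => [/existsP[y sy]|/existsPn h].
    rewrite (bigD1 y) //= sy big1 ?addr0 // => y' ny.
    by rewrite (slabE _ _ _ sy) (negbTE (ny : y' != y :> nat)).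
  by rewrite big1 // => y _; rewrite (negbTE (h y)).
(* A boundary edge outside all the slabs is not in [G]; its gain is -1 and may be dropped. *)
rewrite !big -big_split /=; apply: ler_sum => e _.
case: ifP => [/existsP[y /andP[/eqP e2 _]]|nj].
  case: ifP => [/existsP[y' /andP[/eqP e2' _]]|_]; last by rewrite addr0.
  by move: ij; rewrite -e2 -e2' eqxx.
case: ifP => [_|ni]; first by rewrite add0r.
rewrite /gain; case: ifP => // /hG /orP[] /andP[/eqP e2 /existsP[y /orP[]/eqP e1]].
- by case/negP: (negbT nj); apply/existsP; exists y; rewrite /s e2 e1 unitvnE !eqxx /= mul1n eqxx.
- case/negP: (negbT nj); apply/existsP; exists y; rewrite /s e2 e1 mxE !unitvnE !eqxx /=.
  by rewrite (negbTE ji) mul0n mul1n add0r eqxx.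
- by case/negP: (negbT ni); apply/existsP; exists y; rewrite /s e2 e1 unitvnE !eqxx /= mul1n eqxx.
- case/negP: (negbT ni); apply/existsP; exists y; rewrite /s e2 e1 mxE !unitvnE !eqxx /=.
  by rewrite (negbTE ij) mul0n mul1n add0r eqxx.
Qed.

(** * Weights of the high temperature expansion *)

Section Weight.
Variables (R : realFieldType) (t u : R).
Hypotheses (t0 : 0 < t) (u0 : 0 < u).

Definition edgew (G : pred (pedge m)) e : R := if G e then u^-1 else u.

Definition wt (G : pred (pedge m)) K : R :=
  t ^+ #|` K| * \prod_(e <- bdy K) edgew G e.

Lemma edgew_gt0 G e : 0 < edgew G e.
Proof. by rewrite /edgew; case: ifP; rewrite ?invr_gt0. Qed.

Lemma wt_gt0 G K : 0 < wt G K.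
Proof.
rewrite mulr_gt0 ?exprn_gt0 // prodr_gt0 // => e _; exact: edgew_gt0.
Qed.

Lemma wt0 G : wt G fset0 = 1.
Proof.
rewrite /wt cardfs0 expr0 mul1r big_seq big1 // => e; rewrite mem_bdy /bd.
by rewrite big_seq_fset0.
Qed.

Lemma wtU G K Q : sep adj K Q -> wt G (K `|` Q) = wt G K * wt G Q.
Proof.
move=> sKQ; have d := sep_disjoint adjxx sKQ.
rewrite /wt cardfsU (disjoint_fsetI0 d) cardfs0 subn0 exprD mulrACA; congr (_ * _).
have dis e : bd K e -> bd Q e = false.
  move=> /bd_supp[p pK ep]; apply/negP => /bd_supp[q qQ eq].
  have /sepP/(_ p q pK qQ) := sKQ; rewrite /adj negb_or => /andP[_].
  by move/hasPn/(_ e ep) => /=; rewrite eq.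
rewrite (big_fsetID _ (fun e => bd K e)); congr (_ * _); apply: eq_fbigl => e.
  by rewrite in_fset_sep !mem_bdy bdU //; case: (boolP (bd K e)) => [/dis->|_]; rewrite ?andbF.
by rewrite in_fset_sep !mem_bdy bdU // andbC; case: (boolP (bd K e)) => [/dis->|_].
Qed.

(* The weight only sees the restriction of [G] to the edges of [K]. *)
Lemma eq_wt G G' K : (forall p e, p \in K -> e \in edges p -> G e = G' e) ->
  wt G K = wt G' K.
Proof.
move=> h; congr (_ * _); rewrite big_seq [RHS]big_seq; apply: eq_bigr => e.
by rewrite mem_bdy => /bd_supp[p pK ep]; rewrite /edgew (h p).
Qed.

Lemma wt_imfset (f : pplaq m -> pplaq m) (g : pedge m -> pedge m) G G' K :
  injective f -> injective g ->
  (forall p, edges (f p) =i [seq g e | e <- edges p]) ->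
  (forall e, G' (g e) = G e) ->
  wt G' [fset f p | p in K] = wt G K.
Proof.
move=> fI gI fg GG; rewrite /wt card_imfset //; congr (_ * _).
have -> : bdy [fset f p | p in K] = [fset g e | e in bdy K].
  apply/fsetP => e; rewrite mem_bdy /bd big_imfset; last by move=> p q _ _ /fI.
  apply/idP/imfsetP => /= [h|[e' + ->]]; last first.
    rewrite mem_bdy /bd; congr (odd _ : Prop); apply: eq_bigr => p _.
    by rewrite fg (mem_map gI).
  have [p pK ep] : exists2 p, p \in K & e \in edges (f p).
    apply: contrapT => nh; move: h; rewrite big_seq big1 //.
    by move=> p pK; apply/eqP; rewrite eqb0; apply/negP => ep; apply: nh; exists p.
  move: ep; rewrite fg => /mapP[e' /= e'p ee']; exists e' => //.
  rewrite mem_bdy /bd; move: h; rewrite ee'; congr (odd _ : Prop); apply: eq_bigr => q _.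
  by rewrite fg (mem_map gI).
rewrite big_imfset /=; last by move=> p q _ _ /gI.
by apply: eq_bigr => e _; rewrite /edgew GG.
Qed.

Lemma Z_imfset (f : pplaq m -> pplaq m) (g : pedge m -> pedge m) G G' S :
  injective f -> injective g ->
  (forall p, edges (f p) =i [seq g e | e <- edges p]) ->
  (forall e, G' (g e) = G e) ->
  Z (wt G') [fset f p | p in S] = Z (wt G) S.
Proof.
move=> fI gI fg GG; rewrite /Z sum_fpowerset_imfset //; apply: eq_bigr => K _.
exact: wt_imfset fg GG.
Qed.

Lemma prod_edgew G K :
  \prod_(e <- bdy K) edgew G e = u^-1 ^ (\sum_(e <- bdy K) gain G e).
Proof.
have uV : u^-1 != 0 by rewrite invr_eq0 gt_eqF.
rewrite (big_morph (fun n : int => u^-1 ^ n) (fun a b => expfzDr a b uV) (expr0z _)).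
by apply: eq_bigr => e _; rewrite /edgew /gain; case: ifP; rewrite ?expr1z // exprN1 invrK.
Qed.

(** By [rectangle_gain], the [l]-th power of the edge product is at most [u^-1 ^+ (4 * #|]
    K|)[, hence at most]x ^+ (l * #|[K|)]; [l]-th roots are then taken. *)
Lemma wt_le (i j : 'I_m) (T L l : nat) K (G : pred (pedge m)) (x : R) :
  i != j -> (l <= T)%N -> (l <= L)%N ->
  (forall e, G e -> sides i j T L e || sides j i L T e) ->
  u <= 1 -> 0 < x -> u^-1 ^+ 4 <= x ^+ l -> (0 < l)%N ->
  wt G K <= (t * x) ^+ #|` K|.
Proof.
move=> ij lT lL hG u1 x0 ux l0; rewrite /wt exprMn ler_wpM2l ?exprn_ge0 ?(ltW t0) //.
have uV0 : 0 < u^-1 by rewrite invr_gt0.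
rewrite -(ler_pXn2r l0) ?nnegrE ?exprn_ge0 ?(ltW x0) //; last first.
  by rewrite ltW // prodr_gt0 // => e _; apply: edgew_gt0.
rewrite prod_edgew // [(_ ^ _) ^+ l]exprnP exprz_exp -!exprM.
apply: le_trans (_ : u^-1 ^+ (4 * #|` K|) <= _).
  rewrite [leRHS]exprnP ler_weXz2l //; first by rewrite invf_ge1.
  by rewrite mulrC; apply: rectangle_gain ij lT lL hG.
by rewrite exprM mulnC exprM lerXn2r ?nnegrE ?exprn_ge0 ?(ltW x0) ?(ltW uV0).
Qed.

End Weight.
End Lattice.

(** * Real analysis *)

Section Analysis.
Variable R : realType.

Lemma bernoulli (y : R) n : 0 <= y <= 1 -> 1 - n%:R * y <= (1 - y) ^+ n.
Proof.
move=> /andP[y0 y1]; elim: n => [|n IH]; first by rewrite mul0r subr0 expr0.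
rewrite exprS; apply: le_trans (_ : (1 - y) * (1 - n%:R * y) <= _).
  by have h : 0 <= n%:R * (y * y) by [rewrite !mulr_ge0]; rewrite -[n.+1%:R]natr1; nra.
by rewrite ler_wpM2l // subr_ge0.
Qed.

(* [1 - (1 - q) / n] is a substitute for the n-th root of [q]. *)
Lemma root_bound (q : R) n : 0 < q < 1 -> (0 < n)%N ->
  exists2 x : R, 0 < x < 1 & q <= x ^+ n.
Proof.
move=> /andP[q0 q1] n0; have n1 : 1 <= n%:R :> R by rewrite ler1n.
have y0 : 0 < (1 - q) / n%:R by rewrite divr_gt0 ?subr_gt0 //; lra.
have y1 : (1 - q) / n%:R < 1 by rewrite ltr_pdivrMr; lra.
exists (1 - (1 - q) / n%:R); first by rewrite subr_gt0 y1 /=; lra.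
apply: le_trans (bernoulli _ _); last by rewrite (ltW y0) (ltW y1).
by rewrite mulrC divfK ?gt_eqF; lra.
Qed.

Lemma ln_dist (x y : R) : 1 <= x -> 1 <= y -> `|ln x - ln y| <= `|x - y|.
Proof.
have aux (a b : R) : 1 <= a -> 1 <= b -> ln a - ln b <= `|a - b|.
  move=> a1 b1; have a0 : 0 < a by lra.
  have b0 : 0 < b by lra.
  rewrite -ln_div ?posrE //; apply: le_trans (_ : a / b - 1 <= _).
    have := @expR_ge1Dx R (ln (a / b)); rewrite lnK ?posrE ?divr_gt0 //; lra.
  have -> : a / b - 1 = (a - b) / b by rewrite mulrBl divff ?gt_eqF.
  apply: le_trans (ler_norm _) _; rewrite normrM normfV (gtr0_norm b0).
  by rewrite ler_pdivrMr // ler_peMr.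
move=> x1 y1; rewrite ler_norml aux // andbT lerNl opprB distrC.
exact: aux.
Qed.

Lemma expr_minn (y : R) a b c : 0 <= y ->
  y ^+ minn (minn a b) c <= y ^+ a + y ^+ b + y ^+ c.
Proof.
move=> y0; have aux k l : y ^+ minn k l <= y ^+ k + y ^+ l.
  by rewrite /minn; case: (k < l)%N; rewrite ?lerDl ?lerDr exprn_ge0.
by apply: le_trans (aux _ _) _; rewrite lerD2r.
Qed.

(** Convergence of neither sequence is assumed. In the main use [a] is log rho along the rectangles
    and [b] the contribution of balls around the meeting points. *)
Lemma dist_limit (a b eps : nat -> R) : eps @ \oo --> (0 : R) ->
  (forall M, \forall N \near \oo, `|a N - b M| <= eps M) ->
  exists2 x : R, a @ \oo --> x & b @ \oo --> x.
Proof.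
move=> eps0 ab; have ca : cvgn a.
  apply/cauchy_cvgP; apply/cauchy_exP => e e0.
  have /cvgrPdist_lt/(_ e e0)[M _ /(_ M (leqnn M)) eM] := eps0.
  rewrite sub0r normrN in eM; exists (b M); near=> N.
  apply: (@le_lt_trans _ _ (eps M)); last exact: le_lt_trans (ler_norm _) eM.
  by rewrite distrC; near: N; apply: ab.
exists (limn a) => //; apply/cvgrPdist_le => e e0.
have e2 : 0 < e / 2 by rewrite divr_gt0.
near=> M.
have [N [aN abN]] : exists N, `|limn a - a N| < e / 2 /\ `|a N - b M| <= eps M.
  have h : \forall N \near \oo, `|limn a - a N| < e / 2 /\ `|a N - b M| <= eps M.
    by apply: filterI; [move/cvgrPdist_lt: ca; apply | exact: ab].
  by have [N _ /(_ N (leqnn N)) hN] := h; exists N.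
have eM : eps M < e / 2.
  apply: le_lt_trans (ler_norm _) _; rewrite -normrN -sub0r; near: M.
  by move/cvgrPdist_lt: eps0; apply.
have := ler_normD (limn a - a N) (a N - b M); rewrite addrA subrK.
move=> h; apply: le_trans h _; rewrite [e]splitr; apply: lerD; first exact: ltW.
exact: le_trans abN (ltW eM).
Unshelve. all: by end_near. Qed.

Lemma telescope_dist (V : choiceType) (F : {fset V} -> R) (b : V -> R) A S :
  (forall S p, p \in A -> p \notin S -> `|F (p |` S) - F S| <= b p) ->
  [disjoint A & S]%fset -> `|F (A `|` S) - F S| <= \sum_(p <- A) b p.
Proof.
elim/fset1U_rect: A => [|a A aA IH] hF.
  by rewrite fset0U subrr normr0 big_seq_fset0.
rewrite fdisjointU1X => /andP[aS dAS]; rewrite big_fsetU1 //= -fsetUA.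
apply: le_trans (_ : `|F (a |` (A `|` S)) - F (A `|` S)| + `|F (A `|` S) - F S| <= _).
  by rewrite -[X in `|X|](subrKA (F (A `|` S))) ler_normD.
apply: lerD; first by apply: hF; rewrite ?inE ?eqxx // negb_or aA.
by apply: IH => // S' p pA; apply: hF; rewrite inE pA orbT.
Qed.

Section Geometric.
Variable x : R.
Hypothesis x01 : 0 < x < 1.

Lemma geometric_two_sided L : \sum_(v < L.*2.+1) x ^+ absz (v%:Z - L%:Z) <= 2 / (1 - x).
Proof.
have /andP[x0 x1] := x01.
have geo n : \sum_(v < n) x ^+ v <= 1 / (1 - x).
  rewrite ler_pdivlMr ?subr_gt0 // mulrC.
  have -> : (1 - x) * \sum_(v < n) x ^+ v = 1 - x ^+ n.
    by rewrite -[RHS]opprB subrX1 -mulNr opprB.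
  by rewrite gerBl exprn_ge0 // ltW.
rewrite -addnn -addnS big_split_ord /=.
apply: le_trans (_ : 1 / (1 - x) + 1 / (1 - x) <= _); last by rewrite -mulrDl.
apply: lerD.
  apply: le_trans (geo L.+1); rewrite (reindex_inj rev_ord_inj) /= [leRHS]big_ord_recl.
  rewrite -[leLHS]add0r; apply: lerD => //; apply: ler_sum => v _.
  rewrite le_eqVlt; apply/orP; left; apply/eqP; congr (x ^+ _).
  by rewrite /= /bump; have := ltn_ord v; lia.
apply: le_trans (geo L.+1); apply: ler_sum => v _.
by rewrite PoszD addrAC subrr add0r.
Qed.
End Geometric.

(** With [q <= x ^+ m], the decay in the sup norm is dominated by a product of one-dimensional
    decays, as [m * nrm y] is at least the sum of the [|y_k|]. The bound is uniform in the finite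
    set and in the centre. *)
Lemma geometric_lattice_sum (m : nat) (q : R) : 0 < q < 1 ->
  exists2 C : R, 0 < C & forall (A : {fset pplaq m}) (c : site m),
    \sum_(p <- A) q ^+ nrm (p.1.1 - c) <= C.
Proof.
move=> q01; have [m0|m0] := posnP m.
  exists 1 => // A c; suff -> : A = fset0 by rewrite big_seq_fset0.
  by apply/fsetP => -[[? a] ?]; have := ltn_ord a; rewrite {2}m0.
have [x x01 qx] := root_bound q01 m0.
have /andP[x0 x1] := x01; have /andP[q0 q1] := q01.
have C0 : 0 < (2 / (1 - x)) ^+ m by rewrite exprn_gt0 // divr_gt0 // subr_gt0.
exists ((2 / (1 - x)) ^+ m * (m * m)%N%:R); first by rewrite mulr_gt0 // ltr0n muln_gt0 m0.
(* [A] fits into a cube of radius [L] around [c], over which the product sum factorises. *)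
move=> A c; pose L := \max_(p <- A) nrm (p.1.1 - c).
pose f (v : {ffun 'I_m -> 'I_(L.*2.+1)} * ('I_m * 'I_m)) : pplaq m :=
  (c + \row_k ((v.1 k)%:Z - L%:Z), v.2.1, v.2.2).
have fI : injective f.
  move=> [v [a b]] [v' [a' b']] [/addrI e -> ->]; congr (_, _).
  apply/ffunP => k; apply: val_inj.
  have /rowP/(_ k) := e; rewrite !mxE /=; lia.
pose B := [fset f v | v in {: {ffun 'I_m -> 'I_(L.*2.+1)} * ('I_m * 'I_m)}].
apply: le_trans (_ : \sum_(p <- B) q ^+ nrm (p.1.1 - c) <= _).
  have AB : A `<=` B.
    apply/fsubsetP => p pA; have pL : (nrm (p.1.1 - c) <= L)%N.
      by rewrite /L; apply: leq_bigmax_seq.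
    apply/imfsetP; exists ([ffun k : 'I_m => inord (absz ((p.1.1 - c) 0 k + L%:Z))], (p.1.2, p.2)) => //.
    case: p pA pL => [[y a] b] _ pL; congr (_, _, _).
    apply/rowP => k; rewrite !mxE ffunE inordK; have := nrm_coord (y - c) k;
      rewrite /= !mxE; move: pL => /=; move: (nrm _); lia.
  rewrite [leRHS](big_fsetID _ (fun p => p \in A)) /=.
  rewrite -[leLHS]addr0; apply: lerD; last by apply: sumr_ge0 => p _; rewrite exprn_ge0 ?ltW.
  rewrite le_eqVlt; apply/orP; left; apply/eqP; apply: eq_fbigl => p.
  rewrite in_fset_sep; have [pA|] := boolP (p \in A); rewrite ?andbF // andbT.
  by rewrite (fsubsetP AB).
rewrite big_imfset /=; last by move=> v v' _ _ /fI.
rewrite big_enum /=.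
have bound (y : site m) : q ^+ nrm y <= \prod_k x ^+ absz (y 0 k).
  apply: le_trans (_ : x ^+ (m * nrm y) <= _).
    by rewrite exprM lerXn2r ?nnegrE ?exprn_ge0 ?(ltW q0) ?(ltW x0).
  rewrite prodrXr ler_wiXn2l ?(ltW x0) ?(ltW x1) //.
  rewrite -[X in (_ <= X * _)%N]card_ord -sum_nat_const.
  by apply: leq_sum => k _; apply: nrm_coord.
apply: le_trans (_ : \sum_(v : {ffun 'I_m -> 'I_(L.*2.+1)} * ('I_m * 'I_m))
   \prod_k x ^+ absz ((v.1 k)%:Z - L%:Z) <= _).
  apply: ler_sum => v _; apply: le_trans (bound _) _.
  rewrite le_eqVlt; apply/orP; left; apply/eqP; apply: eq_bigr => k _.
  by rewrite /= addrAC subrr add0r mxE.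
rewrite -(pair_big xpredT xpredT (fun (v : {ffun 'I_m -> 'I_(L.*2.+1)}) (_ : 'I_m * 'I_m) =>
   \prod_k x ^+ absz ((v k)%:Z - L%:Z))) /=.
under eq_bigr do rewrite sumr_const card_prod card_ord.
rewrite sumrMnl -[leLHS]mulr_natr ler_wpM2r //.
rewrite -(bigA_distr_bigA (fun (k : 'I_m) (v : 'I_(L.*2.+1)) => x ^+ absz (v%:Z - L%:Z))).
rewrite prodr_const card_ord lerXn2r ?nnegrE ?(ltW (divr_gt0 _ _)) ?subr_gt0 //.
  by apply: sumr_ge0 => v _; rewrite exprn_ge0 // ltW.
exact: geometric_two_sided.
Qed.

End Analysis.

(** * Volumes and the two halves of the rectangle *)

Section Volumes.
Variable m : nat.
Implicit Types (e : pedge m) (p : pplaq m).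

Lemma mem_box N (x : site m) : (x \in box m N) = (nrm x <= N)%N.
Proof.
rewrite in_box; apply/forallP/nrmP => h k; have := h k; move: (x 0 k) => xk; lia.
Qed.

Definition volume N : {fset pplaq m} :=
  [fset p in box m N `*` dirs m `*` dirs m |
    (p.1.2 < p.2)%N && all (mem (box m N)) (corners (pos p))].

(** Unlike [volume], this depends on the base point alone, so a genuine plaquette outside it has a
    base point of norm greater than [M]. *)
Definition ball M : {fset pplaq m} :=
  [fset p in box m M `*` dirs m `*` dirs m | (p.1.2 < p.2)%N].

Lemma mem_dirs (k : 'I_m) : k \in dirs m.
Proof. by rewrite !inE. Qed.

Lemma mem_ball M p : (p \in ball M) = (nrm p.1.1 <= M)%N && (p.1.2 < p.2)%N.
Proof. by rewrite in_fset_sep !in_fsetM mem_box !mem_dirs !andbT. Qed.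

Lemma mem_volume N p : (p \in volume N) =
  (p.1.2 < p.2)%N && all (fun x => nrm x <= N)%N (corners (pos p)).
Proof.
rewrite in_fset_sep !in_fsetM mem_box !mem_dirs !andbT.
have -> : all (mem (box m N)) (corners (pos p)) = all (fun x => nrm x <= N)%N (corners (pos p)).
  by apply: eq_all => x; rewrite /= mem_box.
case: p => [[x a] b] /=; case: (nrm x <= N)%N; rewrite ?andbF //.
Qed.

Lemma corner_near p y : y \in corners (pos p) ->
  forall k, p.1.1 0 k <= y 0 k <= p.1.1 0 k + 2.
Proof.
case: p => [[x a] b] /=; rewrite !inE => + k.
have b01 (c : bool) : 0 <= (c%:R : int) <= 1 by case: c.
have := b01 (k == a); have := b01 (k == b).
by move=> ? ? /or4P[] /eqP ->; rewrite ?mxE ?eqxx /=; lia.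
Qed.

Lemma volume_ball N M p : p \in ball M -> (M.+2 <= N)%N -> p \in volume N.
Proof.
rewrite mem_ball mem_volume => /andP[pM ->] MN /=; apply/allP => y yp.
apply/nrmP => k; have := corner_near yp k; have := nrm_coord p.1.1 k.
by move: (p.1.1 0 k) (y 0 k) (nrm _) pM; lia.
Qed.

Lemma volumeN_far N p : (p.1.2 < p.2)%N -> p \notin volume N -> (N <= (nrm p.1.1).+2)%N.
Proof.
move=> ab; rewrite leqNgt; apply: contra => pN; apply: (volume_ball (M := nrm p.1.1)) => //.
  by rewrite mem_ball leqnn.
exact: ltnW.
Qed.

Lemma volume_valid N p : p \in volume N -> (p.1.2 < p.2)%N.
Proof. by rewrite mem_volume => /andP[]. Qed.

Lemma volume_sub N N' : (N <= N')%N -> volume N `<=` volume N'.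
Proof.
move=> NN; apply/fsubsetP => p; rewrite !mem_volume => /andP[-> h] /=.
by apply/allP => x /(allP h) xN; apply: leq_trans xN NN.
Qed.

Definition shift (v : site m) p : pplaq m := (p.1.1 + v, p.1.2, p.2).
Definition shift_edge (v : site m) e : pedge m := (e.1 + v, e.2).

Lemma shift_inj v : injective (shift v).
Proof. by move=> [[x a] b] [[x' a'] b'] [/addIr -> -> ->]. Qed.

Lemma shift_edge_inj v : injective (shift_edge v).
Proof. by move=> [x a] [x' a'] [/addIr -> ->]. Qed.

Lemma edges_shift v p : edges (shift v p) =i [seq shift_edge v e | e <- edges p].
Proof.
move=> e; rewrite /edges /=; case: ifP => //= _.
by rewrite /shift_edge /= ![_ + v + _]addrAC.
Qed.

Lemma mem_shift v (A : {fset pplaq m}) p : (p \in [fset shift v q | q in A]) = (shift (- v) p \in A).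
Proof.
apply/imfsetP/idP => /= [[q qA ->]|h].
  by case: q qA => [[x a] b]; rewrite /shift /= addrK.
by exists (shift (- v) p) => //; case: p h => [[x a] b]; rewrite /shift /= subrK.
Qed.

Lemma shift_ball_volume v M N : (nrm v + M.+2 <= N)%N ->
  [fset shift v p | p in ball M] `<=` volume N.
Proof.
move=> vN; apply/fsubsetP => p; rewrite mem_shift mem_ball => /andP[/= pM pv].
apply: (@volume_ball _ (M + nrm v)); last by move: vN; rewrite addnC addSn addSn.
rewrite mem_ball pv andbT -[p.1.1](subrK v).
by apply: leq_trans (nrmD _ _) _; rewrite leq_add2r.
Qed.

Definition seg (x : site m) (i : 'I_m) (L : nat) : seq (pedge m) :=
  [seq (x + unitv i *+ n, i) | n <- iota 0 L].

Lemma mem_seg x i L e : (e \in seg x i L) =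
  (e.2 == i) && [forall k, if k == i then x 0 k <= e.1 0 k < x 0 k + L%:Z
                           else e.1 0 k == x 0 k].
Proof.
apply/mapP/andP => [[n]|[/eqP ei /forallP h]].
  rewrite mem_iota => /andP[_ nL] -> /=; split => //; apply/forallP => k.
  rewrite mxE unitvnE; case: (k == i); rewrite ?mul0n ?addr0 // mul1n.
  by move: (x 0 k); lia.
have := h i; rewrite eqxx => hi; exists `|e.1 0%R i - x 0%R i|%N.
  by rewrite mem_iota; move: (e.1 _ _) (x _ _) hi; lia.
case: e ei hi h => y k /= -> hi h; congr (_, _); apply/rowP => l.
rewrite mxE unitvnE; have := h l; case: eqP => [->|_ /eqP ->]; rewrite ?mul0n ?addr0 // mul1n.
by move: (y _ _) (x _ _); lia.
Qed.

Lemma seg_uniq x i L : uniq (seg x i L).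
Proof.
rewrite map_inj_uniq ?iota_uniq // => a b [/addrI/rowP/(_ i)].
by rewrite !unitvnE eqxx !mul1n => -[].
Qed.

Lemma segP x i L e k : e \in seg x i L ->
  if k == i then is_true (x 0 k <= e.1 0 k < x 0 k + L%:Z) else e.1 0 k = x 0 k.
Proof.
by rewrite mem_seg => /andP[_ /forallP/(_ k)]; case: (k == i) => // /eqP.
Qed.

(** * The two halves of the rectangle and their shape near the meeting points *)

Section Halves.
Variables (i j : 'I_m) (r T : nat).

Definition half1 : seq (pedge m) :=
  seg 0 i T ++ seg (unitv i *+ T) j r ++ seg 0 j r.
Definition half2 : seq (pedge m) :=
  seg (unitv j *+ (2 * r)) i T ++ seg (unitv i *+ T + unitv j *+ r) j r
  ++ seg (unitv j *+ r) j r.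

Hypothesis ij : i != j.

Lemma half_sides e : (e \in half1) || (e \in half2) ->
  sides i j T (2 * r) e || sides j i (2 * r) T e.
Proof.
have ji : (j == i) = false by rewrite eq_sym (negbTE ij).
have ijF := negbTE ij.
have side_j (x : site m) (a b : nat) : (a + b <= 2 * r)%N ->
    x = unitv j *+ a \/ x = unitv i *+ T + unitv j *+ a ->
    e \in seg x j b -> sides i j T (2 * r) e.
  move=> ab hx /mapP[n]; rewrite mem_iota => /andP[_ nb] -> /=.
  rewrite /sides eqxx /=; have nr : (a + n < 2 * r)%N by lia.
  apply/existsP; exists (Ordinal nr) => /=.
  by case: hx => ->; rewrite ?mulrnDr ?addrA eqxx ?orbT.
have side_i (x : site m) :
    x = 0 \/ x = unitv j *+ (2 * r) ->
    e \in seg x i T -> sides j i (2 * r) T e.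
  move=> hx /mapP[n]; rewrite mem_iota => /andP[_ nb] -> /=.
  rewrite /sides eqxx /=; apply/existsP; exists (Ordinal nb) => /=.
  by case: hx => ->; rewrite ?add0r eqxx ?orbT.
rewrite !mem_cat => /orP[] /or3P[] h.
- by rewrite (side_i 0) ?orbT //; left.
- by rewrite (side_j _ 0%N _ _ _ h) //; [lia|right; rewrite mulr0n addr0].
- by rewrite (side_j _ 0%N _ _ _ h) //; [lia|left].
- by rewrite (side_i _ _ h) ?orbT //; right.
- by rewrite (side_j _ r _ _ _ h) //; [lia|right].
- by rewrite (side_j _ r _ _ _ h) //; [lia|left].
Qed.

(** Lower bound for the distance from [x] to the half beyond the hyperplane at height [r]. The
    vertical sides of that half are nearest to [x] at height [r], at the meeting points. Its
    horizontal side is at distance at least [r], and also lies within radius [T + 2 * r] of the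
    origin, which gives decay for remote [x]. *)
Definition far_dist (x : site m) : nat :=
  minn (minn (nrm (x - unitv j *+ r)) (nrm (x - (unitv i *+ T + unitv j *+ r))))
       (maxn r (nrm x - (T + 2 * r))).

Lemma far_half2 (x : site m) e : x 0 j < r%:Z -> e \in half2 -> (far_dist x <= nrm (e.1 - x))%N.
Proof.
move=> xr; have ijF := negbTE ij; have jiF : (j == i) = false by rewrite eq_sym.
rewrite !mem_cat /far_dist => /or3P[] h.
- apply: leq_trans (geq_minr _ _) _; rewrite geq_max; apply/andP; split.
    apply: leq_trans (nrm_coord _ j); have := segP j h.
    by rewrite jiF !mxE unitvnE eqxx mul1n => ->; move: (x 0 j) xr; lia.
  rewrite leq_subLR; apply/nrmP => k; have := segP k h; have := nrm_coord (e.1 - x) k.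
  rewrite !mxE !unitvnE; case: (k == i); case: (k == j); rewrite ?mul0n ?mul1n;
    move: (x 0 k) (e.1 0 k) (nrm _); lia.
- apply: leq_trans (geq_minl _ _) _; apply: leq_trans (geq_minr _ _) _.
  apply/nrmP => k; have := segP k h; have := nrm_coord (e.1 - x) k.
  rewrite !mxE !unitvnE; case: (eqVneq k j) => [->|_]; rewrite ?mul0n ?mul1n.
    by rewrite jiF mul0n; move: (x 0 j) xr (e.1 0 j) (nrm _); lia.
  by move: (x 0 k) (e.1 0 k) (nrm _); lia.
- apply: leq_trans (geq_minl _ _) _; apply: leq_trans (geq_minl _ _) _.
  apply/nrmP => k; have := segP k h; have := nrm_coord (e.1 - x) k.
  rewrite !mxE !unitvnE; case: (eqVneq k j) => [->|_]; rewrite ?mul0n ?mul1n.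
    by move: (x 0 j) xr (e.1 0 j) (nrm _); lia.
  by move: (x 0 k) (e.1 0 k) (nrm _); lia.
Qed.

Lemma far_half1 (x : site m) e : r%:Z <= x 0 j -> e \in half1 -> (far_dist x <= nrm (e.1 - x))%N.
Proof.
move=> xr; have ijF := negbTE ij; have jiF : (j == i) = false by rewrite eq_sym.
rewrite !mem_cat /far_dist => /or3P[] h.
- apply: leq_trans (geq_minr _ _) _; rewrite geq_max; apply/andP; split.
    apply: leq_trans (nrm_coord _ j); have := segP j h.
    by rewrite jiF !mxE => ->; move: (x 0 j) xr; lia.
  rewrite leq_subLR; apply/nrmP => k; have := segP k h; have := nrm_coord (e.1 - x) k.
  rewrite !mxE; case: (k == i);
    move: (x 0 k) (e.1 0 k) (nrm _); lia.
- apply: leq_trans (geq_minl _ _) _; apply: leq_trans (geq_minr _ _) _.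
  apply/nrmP => k; have := segP k h; have := nrm_coord (e.1 - x) k.
  rewrite !mxE !unitvnE; case: (eqVneq k j) => [->|_]; rewrite ?mul0n ?mul1n.
    by rewrite jiF mul0n; move: (x 0 j) xr (e.1 0 j) (nrm _); lia.
  by move: (x 0 k) (e.1 0 k) (nrm _); lia.
- apply: leq_trans (geq_minl _ _) _; apply: leq_trans (geq_minl _ _) _.
  apply/nrmP => k; have := segP k h; have := nrm_coord (e.1 - x) k.
  rewrite !mxE !unitvnE; case: (eqVneq k j) => [->|_]; rewrite ?mul0n ?mul1n.
    by move: (x 0 j) xr (e.1 0 j) (nrm _); lia.
  by move: (x 0 k) (e.1 0 k) (nrm _); lia.
Qed.

Definition ray (s : bool) : pred (pedge m) := fun e =>
  [&& e.2 == j, (0 <= e.1 0 j) == s & [forall k, (k != j) ==> (e.1 0 k == 0)]].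

Lemma mem_seg_shift (O x : site m) L e :
  (forall k, k != j -> x 0 k = O 0 k) ->
  (shift_edge O e \in seg x j L) =
  [&& e.2 == j, x 0 j <= e.1 0 j + O 0 j < x 0 j + L%:Z &
      [forall k, (k != j) ==> (e.1 0 k == 0)]].
Proof.
move=> xO; rewrite mem_seg /=; congr (_ && _).
apply/forallP/andP => [h|[h1 /forallP h2] k].
  split; first by have := h j; rewrite eqxx mxE.
  apply/forallP => k; apply/implyP => kj; have := h k.
  by rewrite (negbTE kj) (xO k kj) mxE -subr_eq0 addrK.
case: (eqVneq k j) => [->|kj]; first by rewrite mxE.
by have := h2 k; rewrite kj mxE (xO k kj) /= => /eqP ->; rewrite add0r.
Qed.

(** [M < T] keeps the opposite vertical side out of sight, [M < r] the horizontal sides and the far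
    ends of the vertical one. *)
Lemma half_near (O : site m) (M : nat) e :
  O = unitv j *+ r \/ O = unitv i *+ T + unitv j *+ r ->
  (nrm e.1 <= M)%N -> (M < r)%N -> (M < T)%N ->
  (shift_edge O e \in half1) = ray false e /\ (shift_edge O e \in half2) = ray true e.
Proof.
move=> hO eM Mr MT; have ijF := negbTE ij; have jiF : (j == i) = false by rewrite eq_sym.
have ei := leq_trans (nrm_coord e.1 i) eM; have ej := leq_trans (nrm_coord e.1 j) eM.
have Oj : O 0 j = r%:Z.
  by case: hO => ->; rewrite ?mxE !unitvnE eqxx mul1n // jiF mul0n add0r.
have notin_i (x : site m) : x 0 j = 0 \/ x 0 j = (2 * r)%N%:Z ->
    (shift_edge O e \in seg x i T) = false.
  move=> hx; apply/negP => h; have := segP j h; rewrite jiF mxE Oj.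
  by move: (e.1 _ _) ej => ? ?; case: hx => ->; lia.
have notin_j (x : site m) L : (`|O 0%R i - x 0%R i|%N = T) ->
    (shift_edge O e \in seg x j L) = false.
  move=> hx; apply/negP => h; have := segP i h; rewrite ijF mxE.
  by move: (e.1 _ _) (O _ _) (x _ _) ei hx; lia.
have in_j (x : site m) (a : nat) : (forall k, k != j -> x 0 k = O 0 k) ->
    x 0 j = a%:Z -> (shift_edge O e \in seg x j r) =
    [&& e.2 == j, a%:Z <= e.1 0 j + r%:Z < a%:Z + r%:Z &
      [forall k, (k != j) ==> (e.1 0 k == 0)]].
  by move=> xO xj; rewrite mem_seg_shift // xj Oj.
have r1 : (0%:Z <= e.1 0 j + r%:Z < 0%:Z + r%:Z) = ((0 <= e.1 0 j) == false).
  by move: (e.1 _ _) ej; lia.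
have r2 : (r%:Z <= e.1 0 j + r%:Z < r%:Z + r%:Z) = ((0 <= e.1 0 j) == true).
  by move: (e.1 _ _) ej; lia.
have coord := (mxE, unitvnE, eqxx, mul1n, mul0n, ijF, jiF, add0r, addr0).
rewrite !mem_cat !notin_i ?coord; [|by right|by left] => /=.
case: hO => OE; rewrite OE in notin_j in_j *.
- rewrite [_ \in seg (unitv i *+ T) j r]notin_j; last by rewrite !coord; lia.
  rewrite [_ \in seg (unitv i *+ T + _) j r]notin_j; last by rewrite !coord; lia.
  rewrite (in_j _ 0%N) ?(in_j _ r) ?coord // ?r1 ?r2 //.
  by move=> k kj; rewrite !coord (negbTE kj) mul0n.
- rewrite [_ \in seg 0 j r]notin_j; last by rewrite !coord; lia.
  rewrite [_ \in seg (unitv j *+ r) j r]notin_j; last by rewrite !coord; lia.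
  rewrite !orbF (in_j _ 0%N) ?(in_j _ r) ?coord // ?r1 ?r2 //.
  by move=> k kj; rewrite !coord (negbTE kj) mul0n addr0.
Qed.
End Halves.
End Volumes.

(** Turns a decay in the maximum into a simultaneous decay in [n], to sum over plaquettes, and in
    [r], to make the sum small. This is the place where the ratio of the sides must stay bounded. *)
Lemma radius_bound r T C n : (T <= C * r)%N ->
  (n + r <= 2 * (C + 3) * maxn r (n - (T + 2 * r)))%N.
Proof.
move=> TC; have h1 := leq_maxl r (n - (T + 2 * r)).
have h2 := leq_maxr r (n - (T + 2 * r)); move: (maxn _ _) h1 h2 => c h1 h2.
have h3 : (T <= C * c)%N by apply: leq_trans TC _; rewrite leq_mul2l h1 orbT.
have h4 : (n <= (C + 3) * c)%N by move: h2 h3; rewrite mulnDl; lia.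
have h5 : (r <= (C + 3) * c)%N by rewrite mulnDl; lia.
by rewrite -mulnA mul2n -addnn leq_add.
Qed.

(** * Localisation at the meeting points *)

Section Estimates.
Variables (R : realType) (m : nat) (t u tb : R).
Hypotheses (m_gt2 : (2 < m)%N) (tb_ge0 : 0 <= tb)
  (tb_le : 8 * (8 * m.-1)%N%:R * tb <= 8 / 9).
Implicit Types (e : pedge m) (p : pplaq m) (G : pred (pedge m)) (S A B : {fset pplaq m}).

(** With [D = 8 * (m - 1)] and [tb = (8 * m - 12) ^- 2], the quantity [8 * D * tb] equals
    [128 / 144 = 8 / 9] for [m = 3] and is smaller for larger [m]. *)
Local Notation q := (8 / 9 : R).

Let q_gt0 : 0 < q. Proof. by rewrite divr_gt0. Qed.
Let q_lt1 : q < 1. Proof. by rewrite ltr_pdivrMr //; lra. Qed.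
Let D_gt0 : (0 < 8 * m.-1)%N. Proof. by lia. Qed.
Let deg S p : (#|` nbrs (@adj m) S p| <= 8 * m.-1)%N.
Proof. by apply: card_adj; lia. Qed.

Definition lnZ G S : R := ln (Z (wt t u G) S).

Definition good G : Prop := weight (@adj m) tb (wt t u G).

Lemma eq_lnZ G G' S : (forall p e, p \in S -> e \in edges p -> G e = G' e) ->
  lnZ G S = lnZ G' S.
Proof.
move=> GG; congr ln; rewrite /Z big_seq [RHS]big_seq; apply: eq_bigr => K.
rewrite fpowersetE => /fsubsetP KS; apply: eq_wt => p e /KS; exact: GG.
Qed.

(** All ratios are at least 1, where [ln] is 1-Lipschitz, so [decay] passes to logarithms.
    Plaquettes within [d] of [p] have edges based within [d + 1], hence [s = d + 2]; the loss of two
    powers of [q] is covered by [2 * q ^+ 2 >= 1]. *)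
Lemma lnZ_step G G' S p s : good G -> good G' -> p \notin S ->
  (forall e, (nrm (e.1 - p.1.1) < s)%N -> G e = G' e) ->
  `|(lnZ G (p |` S) - lnZ G S) - (lnZ G' (p |` S) - lnZ G' S)| <= 2 * q ^+ s.
Proof.
move=> gG gG' pS GG; have Zp H A : good H -> 0 < Z (wt t u H) A by apply: Z_gt0.
have lnB H : good H -> lnZ H (p |` S) - lnZ H S =
    ln (Z (wt t u H) (p |` S) / Z (wt t u H) S).
  by move=> gH; rewrite ln_div ?posrE ?Zp.
rewrite !lnB //.
have r1 H : good H -> 1 <= Z (wt t u H) (p |` S) / Z (wt t u H) S.
  move=> gH; rewrite ler_pdivlMr ?Zp // mul1r; apply: Z_sub gH _.
  exact: fsubsetUr.
apply: le_trans (ln_dist (r1 _ gG) (r1 _ gG')) _.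
(* For [s <= 1] both ratios lie in [[1, 2]], and [2 * q >= 1]. *)
case: s => [|[|d]] in GG *.
- have := ratio_le2 (@adjC m) (@adjxx m) D_gt0 deg tb_ge0 (ltW q_lt1) tb_le gG pS.
  have := ratio_le2 (@adjC m) (@adjxx m) D_gt0 deg tb_ge0 (ltW q_lt1) tb_le gG' pS.
  have := r1 _ gG; have := r1 _ gG'; move: (_ / _) (_ / _) => a b *.
  by rewrite expr0 ler_norml; apply/andP; split; lra.
- have := ratio_le2 (@adjC m) (@adjxx m) D_gt0 deg tb_ge0 (ltW q_lt1) tb_le gG pS.
  have := ratio_le2 (@adjC m) (@adjxx m) D_gt0 deg tb_ge0 (ltW q_lt1) tb_le gG' pS.
  have := r1 _ gG; have := r1 _ gG'.
  move: (Z _ _ / Z _ _) (Z _ _ / Z _ _) => a b *.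
  by rewrite expr1 ler_norml; apply/andP; split; lra.
apply: le_trans (_ : q ^+ d <= _); last first.
  by rewrite -[d.+2]addn2 exprD mulrCA ler_peMr ?exprn_ge0 ?(ltW q_gt0) //; lra.
apply: (decay (@adjC m) (@adjxx m) D_gt0 deg (@pdistxx m) (@pdist_tri m)
  (@pdist_adj m) tb_ge0 q_gt0 (ltW q_lt1) tb_le gG gG' pS).
move=> K hK; apply: eq_wt => p' e p'K ep'; apply: GG.
have /nrmP := hK _ p'K => pp'; apply/nrmP => k.
have := edge_base ep' k; have := pp' k; rewrite !mxE.
by move: (p.1.1 _ _) (p'.1.1 _ _) (e.1 _ _); lia.
Qed.

Lemma lnZ_sep G A B : good G -> sep (@adj m) A B ->
  lnZ G (A `|` B) = lnZ G A + lnZ G B.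
Proof.
move=> gG sAB; rewrite /lnZ (ZU (@adjxx m) gG sAB) lnM // posrE; exact: Z_gt0 gG.
Qed.

(** The logarithm of rho in a finite volume; the powers of [u] cancel, as the lengths of the halves
    add up. *)
Definition lnrho G1 G2 S : R :=
  lnZ G1 S + lnZ G2 S - lnZ (fun e => G1 e || G2 e) S - lnZ pred0 S.

Lemma lnrho_sep G1 G2 A B : good G1 -> good G2 ->
  good (fun e => G1 e || G2 e) -> good pred0 -> sep (@adj m) A B ->
  lnrho G1 G2 (A `|` B) = lnrho G1 G2 A + lnrho G1 G2 B.
Proof. by move=> g1 g2 g12 g0 sAB; rewrite /lnrho !lnZ_sep //; ring. Qed.

(** Where [G2] is absent, [G1] looks like the union and [G2] like the empty set, so the four
    increments cancel in pairs; symmetrically for [G1]. *)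
Lemma lnrho_step G1 G2 S p s : good G1 -> good G2 ->
  good (fun e => G1 e || G2 e) -> good pred0 -> p \notin S ->
  (forall e, (nrm (e.1 - p.1.1) < s)%N -> G2 e = false) \/
  (forall e, (nrm (e.1 - p.1.1) < s)%N -> G1 e = false) ->
  `|lnrho G1 G2 (p |` S) - lnrho G1 G2 S| <= 4 * q ^+ s.
Proof.
move=> g1 g2 g12 g0 pS; rewrite /lnrho.
case=> h.
- have a1 : forall e, (nrm (e.1 - p.1.1) < s)%N -> G1 e = G1 e || G2 e.
    by move=> e /h ->; rewrite orbF.
  have := lnZ_step g1 g12 pS a1; have := lnZ_step g2 g0 pS h.
  by rewrite !ler_norml => /andP[? ?] /andP[? ?]; apply/andP; split; lra.
- have a1 : forall e, (nrm (e.1 - p.1.1) < s)%N -> G2 e = G1 e || G2 e.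
    by move=> e /h ->.
  have := lnZ_step g2 g12 pS a1; have := lnZ_step g1 g0 pS h.
  by rewrite !ler_norml => /andP[? ?] /andP[? ?]; apply/andP; split; lra.
Qed.

Definition halfp1 i j r T : pred (pedge m) := fun e => e \in half1 i j r T.
Definition halfp2 i j r T : pred (pedge m) := fun e => e \in half2 i j r T.

Definition good_rect i j r T : Prop :=
  [/\ good (halfp1 i j r T), good (halfp2 i j r T),
      good (fun e => halfp1 i j r T e || halfp2 i j r T e) & good pred0].

Lemma lnrho_rect_step i j r T S p : i != j -> good_rect i j r T -> p \notin S ->
  `|lnrho (halfp1 i j r T) (halfp2 i j r T) (p |` S) -
    lnrho (halfp1 i j r T) (halfp2 i j r T) S| <=
  4 * (q ^+ nrm (p.1.1 - unitv j *+ r) +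
       q ^+ nrm (p.1.1 - (unitv i *+ T + unitv j *+ r)) +
       q ^+ maxn r (nrm p.1.1 - (T + 2 * r))).
Proof.
move=> ij [g1 g2 g12 g0] pS.
apply: le_trans (lnrho_step (s := far_dist i j r T p.1.1) g1 g2 g12 g0 pS _) _.
  have [xr|xr] := ltP (p.1.1 0 j) r%:Z; [left|right] => e; apply: contraTF => he;
    rewrite -leqNgt; [exact: far_half2|exact: far_half1].
by rewrite ler_wpM2l // expr_minn // ltW.
Qed.

Lemma ball_sep i j r T M : i != j -> (2 * M + 2 <= T)%N ->
  sep (@adj m) [fset shift (unitv j *+ r) p | p in ball m M]
     [fset shift (unitv i *+ T + unitv j *+ r) p | p in ball m M].
Proof.
move=> ij MT; apply/sepP => a b /imfsetP[p /= + ->] /imfsetP[p' /= + ->].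
rewrite !mem_ball => /andP[pM _] /andP[p'M _]; apply/negP => /pdist_adj/nrmP/(_ i).
have := leq_trans (nrm_coord _ i) pM; have := leq_trans (nrm_coord _ i) p'M.
rewrite /= !mxE !unitvnE eqxx (negbTE ij) mul1n mul0n.
by move: (p.1.1 _ _) (p'.1.1 _ _); lia.
Qed.

Lemma lnZ_shift G G' v M : (forall e, (nrm e.1 <= M.+1)%N -> G' (shift_edge v e) = G e) ->
  lnZ G' [fset shift v p | p in ball m M] = lnZ G (ball m M).
Proof.
move=> GG; transitivity (lnZ (fun e => G (shift_edge (- v) e))
    [fset shift v p | p in ball m M]).
  apply: eq_lnZ => p e; rewrite mem_shift mem_ball /= => /andP[pM _] ep.
  rewrite -(GG (shift_edge (- v) e)); first by rewrite /shift_edge /= subrK -surjective_pairing.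
  apply/nrmP => k; have := edge_base ep k; have := nrm_coord (p.1.1 - v) k.
  by rewrite /= !mxE; move: (nrm _) pM (p.1.1 _ _) (e.1 _ _) (v _ _); lia.
congr ln; apply: (Z_imfset t u _ (@shift_inj m v) (@shift_edge_inj m v)).
  exact: edges_shift.
by move=> [x a]; rewrite /shift_edge /= addrK.
Qed.

Lemma lnrho_shift i j r T M O : i != j -> (M.+1 < r)%N -> (M.+1 < T)%N ->
  O = unitv j *+ r \/ O = unitv i *+ T + unitv j *+ r ->
  lnrho (halfp1 i j r T) (halfp2 i j r T) [fset shift O p | p in ball m M] =
  lnrho (ray j false) (ray j true) (ball m M).
Proof.
move=> ij Mr MT hO.
have near e : (nrm e.1 <= M.+1)%N -> halfp1 i j r T (shift_edge O e) = ray j false e /\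
    halfp2 i j r T (shift_edge O e) = ray j true e.
  by move=> eM; apply: half_near eM Mr MT.
rewrite /lnrho (lnZ_shift (G := ray j false)); last by move=> e /near[].
rewrite (lnZ_shift (G := ray j true)); last by move=> e /near[].
rewrite (lnZ_shift (G := fun e => ray j false e || ray j true e)); last by move=> e /near[-> ->].
by rewrite (lnZ_shift (G := pred0)).
Qed.

(* The interaction of the two halves of the rectangle is concentrated near the
   two points where they meet. *)
Lemma lnrho_volume C : exists x K : R, [/\ 0 < x < 1, 0 <= K &
  forall i j r T M N, i != j -> good_rect i j r T -> (T <= C * r)%N ->
  (M.+1 < r)%N -> (2 * M + 2 <= T)%N -> (r + T + M.+2 <= N)%N ->
  `|lnrho (halfp1 i j r T) (halfp2 i j r T) (volume m N) -
    2 * lnrho (ray j false) (ray j true) (ball m M)| <= K * (x ^+ M + x ^+ r)].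
Proof.
have q01 : 0 < q < 1 by rewrite q_gt0.
(* The exponent of [radius_bound]. Each power of [q] is split into a power of [x] summable over
   plaquettes and a prefactor [x ^+ M] or [x ^+ r]. *)
have [x x01 qx] := @root_bound R q (2 * (C + 3)) q01 ltac:(lia).
have /andP[x0 x1] := x01; have [K K0 hK] := geometric_lattice_sum m x01.
exists x, (8 * K); split=> //; first by rewrite mulr_ge0 // ltW.
move=> i j r T M N ij gd TC Mr MT rN.
pose O1 : site m := unitv j *+ r; pose O2 : site m := unitv i *+ T + unitv j *+ r.
pose B1 := [fset shift O1 p | p in ball m M]; pose B2 := [fset shift O2 p | p in ball m M].
pose F := lnrho (halfp1 i j r T) (halfp2 i j r T).
(* Exact: the balls are separated, and each is a translate of the picture of two opposite rays. *)
have FB : F (B1 `|` B2) = 2 * lnrho (ray j false) (ray j true) (ball m M).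
  have [g1 g2 g12 g0] := gd; have MT' : (M.+1 < T)%N by lia.
  rewrite /F lnrho_sep //; last exact: ball_sep.
  rewrite !lnrho_shift //; [|by right|by left].
  by rewrite mulr_natl mulr2n.
have BV : B1 `|` B2 `<=` volume m N.
  rewrite fsubUset !shift_ball_volume //.
    apply: leq_trans rN; rewrite leq_add2r; apply: leq_trans (nrmD _ _) _.
    by rewrite addnC leq_add ?nrm_unitvn.
  apply: leq_trans rN; rewrite leq_add2r.
  exact: leq_trans (nrm_unitvn _ _) (leq_addr _ _).
rewrite [volume m N](fsetDUK BV).
rewrite -/F -FB; set A := _ `\` _.
pose b p := 4 * (q ^+ nrm (p.1.1 - O1) + q ^+ nrm (p.1.1 - O2) +
       q ^+ maxn r (nrm p.1.1 - (T + 2 * r))).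
apply: le_trans (telescope_dist (b := b) _ _) _.
- by move=> S p _ pS; apply: lnrho_rect_step.
- by apply/fdisjointP => p; rewrite in_fsetD => /andP[].
have qle a c : (c <= 2 * (C + 3) * a)%N -> q ^+ a <= x ^+ c.
  move=> ca; apply: le_trans (_ : x ^+ (2 * (C + 3) * a) <= _).
    by rewrite exprM lerXn2r ?nnegrE ?exprn_ge0 ?(ltW x0) ?(ltW q_gt0).
  by rewrite ler_wiXn2l ?(ltW x0) ?(ltW x1).
apply: le_trans (_ : \sum_(p <- A) 4 * (x ^+ M * x ^+ nrm (p.1.1 - O1) +
   x ^+ M * x ^+ nrm (p.1.1 - O2) + x ^+ r * x ^+ nrm (p.1.1 - 0)) <= _).
  rewrite big_seq [leRHS]big_seq; apply: ler_sum => p; rewrite in_fsetD in_fsetU negb_or.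
  case/andP => /andP[pB1 pB2] pV; have pv := volume_valid pV.
  rewrite /b ler_wpM2l // -!exprD subr0.
  have out O : p \notin [fset shift O p | p in ball m M] -> (M <= nrm (p.1.1 - O))%N.
    by rewrite mem_shift mem_ball /= pv andbT -ltnNge => /ltnW.
  have o1 := out _ pB1; have o2 := out _ pB2.
  have twice a c : (a <= c)%N -> (a + c <= 2 * (C + 3) * c)%N.
    move=> ac; apply: leq_trans (leq_add ac (leqnn c)) _.
    by rewrite addnn -mul2n leq_mul2r leq_pmulr ?addnS ?orbT.
  apply: lerD; first by apply: lerD; apply/qle/twice.
  by apply: qle; rewrite addnC radius_bound.
rewrite -mulr_sumr !big_split /= -!mulr_sumr.
have xM := exprn_ge0 M (ltW x0); have xr := exprn_ge0 r (ltW x0).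
have s1 := ler_wpM2l xM (hK A O1); have s2 := ler_wpM2l xM (hK A O2).
have s3 := ler_wpM2l xr (hK A 0).
apply: le_trans (_ : 4 * (x ^+ M * K + x ^+ M * K + x ^+ r * K) <= _).
  by rewrite ler_wpM2l // !lerD.
have : 0 <= x ^+ r * K by rewrite mulr_ge0 // ltW.
by move: (x ^+ r) (x ^+ M) => y z; nra.
Qed.

(** A plaquette added far out sees [G] only from distance [nrm p.1.1 - L], so its effects on the two
    terms nearly cancel; the errors are summable and the sequence is Cauchy. *)
Lemma lnZ_cvg G L : good G -> good pred0 -> (forall e, G e -> (nrm e.1 <= L)%N) ->
  cvgn (fun N => lnZ G (volume m N) - lnZ pred0 (volume m N)).
Proof.
move=> gG g0 GL; have q01 : 0 < q < 1 by rewrite q_gt0.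
have [x x01 qx] := @root_bound R q 2 q01 isT.
have /andP[x0 x1] := x01; have [K K0 hK] := geometric_lattice_sum m x01.
pose a N := lnZ G (volume m N) - lnZ pred0 (volume m N).
(* [q ^- L] undoes the truncated subtraction of [L], and [x ^- 2] pays for the margin 2 in
   [volumeN_far]. *)
pose c := 2 * (q ^- L * x ^- 2 * K).
have [|M|y ya _] := @dist_limit R a a (fun M => c * x ^+ M).
- rewrite -[0](mulr0 c); apply: cvgMr; apply: cvg_expr.
  by rewrite gtr0_norm.
- exists M => // N /= MN; rewrite /a.
  rewrite [volume m N](fsetDUK (volume_sub m MN)).
  pose F S := lnZ G S - lnZ pred0 S.
  apply: le_trans (telescope_dist (F := F) (b := fun p => 2 * q ^+ (nrm p.1.1 - L)) _ _) _.
  + move=> S p _ pS; rewrite /F.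
    have -> : lnZ G (p |` S) - lnZ pred0 (p |` S) - (lnZ G S - lnZ pred0 S) =
      lnZ G (p |` S) - lnZ G S - (lnZ pred0 (p |` S) - lnZ pred0 S) by ring.
    apply: lnZ_step => // e; apply: contraTF => /GL eL; rewrite -leqNgt leq_subLR.
    have -> : nrm p.1.1 = nrm (e.1 - (e.1 - p.1.1)) by rewrite subKr.
    by apply: leq_trans (nrmD _ _) _; rewrite nrmN leq_add2r.
  + by apply/fdisjointP => p; rewrite in_fsetD => /andP[].
  rewrite -mulr_sumr -mulrA ler_wpM2l //.
  apply: le_trans (_ : \sum_(p <- volume m N `\` volume m M)
     q ^- L * x ^- 2 * (x ^+ M * x ^+ nrm (p.1.1 - 0)) <= _); last first.
    rewrite -mulr_sumr -mulr_sumr -[leRHS]mulrA ler_wpM2l //.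
      by rewrite mulr_ge0 // invr_ge0 exprn_ge0 // ltW.
    by rewrite mulrC ler_wpM2r // exprn_ge0 // ltW.
  rewrite big_seq [leRHS]big_seq; apply: ler_sum => p; rewrite in_fsetD.
  case/andP => pM /volume_valid pv; have {}pM := volumeN_far pv pM.
  rewrite subr0; move: (nrm _) pM => s sM.
  apply: le_trans (_ : q ^- L * q ^+ s <= _).
    have [Ls|Ls] := leqP L s.
      by rewrite -{2}(subnK Ls) exprD mulrCA mulVf ?mulr1 // gt_eqF // exprn_gt0.
    rewrite (eqP (ltnW Ls : _ == _)) expr0 mulrC ler_pdivlMr ?exprn_gt0 //.
    by rewrite mul1r ler_wiXn2l ?(ltW q_gt0) ?(ltW q_lt1) // ltnW.
  rewrite -mulrA ler_wpM2l ?invr_ge0 ?exprn_ge0 ?(ltW q_gt0) //.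
  rewrite [leRHS]mulrC ler_pdivlMr ?exprn_gt0 //.
  apply: le_trans (_ : (x ^+ 2) ^+ s * x ^+ 2 <= _).
    rewrite ler_wpM2r ?exprn_ge0 ?(ltW x0) //.
    by rewrite lerXn2r ?nnegrE ?exprn_ge0 ?(ltW x0) ?(ltW q_gt0).
  by rewrite -exprM -!exprD ler_wiXn2l ?(ltW x0) ?(ltW x1) //; lia.
by apply/cvg_ex; exists y.
Qed.

End Estimates.

(** * Exchange of two directions *)

Section Symmetry.
Variables (m : nat) (a b : 'I_m).
Implicit Types (e : pedge m) (p : pplaq m).

Let s := tperm a b.
Let sK k : s (s k) = k. Proof. exact: tpermK. Qed.
Let sE k l : (s k == l) = (k == s l). Proof. by rewrite -(inj_eq (@perm_inj _ s)) sK. Qed.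

Definition swap_site (x : site m) : site m := \row_k x 0 (tperm a b k).
Definition swap_edge e : pedge m := (swap_site e.1, tperm a b e.2).
(** The directions are reordered so that increasing pairs stay increasing and all others stay
    otherwise; this makes the map an involution on all triples. *)
Definition swap_plaq p : pplaq m :=
  let c := tperm a b p.1.2 in let d := tperm a b p.2 in
  if (p.1.2 < p.2)%N == (c < d)%N then (swap_site p.1.1, c, d)
  else (swap_site p.1.1, d, c).

Lemma swap_siteK : involutive swap_site.
Proof. by move=> x; apply/rowP => k; rewrite !mxE tpermK. Qed.

Lemma swap_edgeK : involutive swap_edge.
Proof. by move=> [x k]; rewrite /swap_edge /= swap_siteK tpermK. Qed.

Lemma swap_plaqK : involutive swap_plaq.
Proof.
move=> [[x k] l]; rewrite /swap_plaq /= -/s.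
case kl: ((k < l)%N == (s k < s l)%N); rewrite /= !sK swap_siteK.
  by rewrite eq_sym kl.
have nkl : k != l by apply: contraFneq kl => ->; rewrite !ltnn.
have nsl : s k != s l by rewrite (inj_eq perm_inj).
suff -> : ((s l < s k)%N == (l < k)%N) = false by [].
move: kl nkl nsl; rewrite -!val_eqE /=.
by case: (ltngtP (s k) (s l)) => //; case: (ltngtP k l).
Qed.

Lemma swap_unitv x k : swap_site (x + unitv k) = swap_site x + unitv (tperm a b k).
Proof. by apply/rowP => l; rewrite !mxE !eqxx /= -/s sE. Qed.

Lemma edges_swap p : edges (swap_plaq p) =i [seq swap_edge e | e <- edges p].
Proof.
case: p => [[x k] l] e; rewrite /swap_plaq /= -/s /edges.
have [kl|kl] := boolP (k < l)%N; last first.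
  case sl: (s k < s l)%N; rewrite /= ?sl //.
  by rewrite ltnNge ltnW.
have : s k != s l by rewrite (inj_eq perm_inj) neq_ltn kl.
rewrite neq_ltn => /orP[] sl; rewrite /= ?sl /= /swap_edge /=.
  by rewrite !swap_unitv.
rewrite [(s k < s l)%N]ltnNge (ltnW sl) /= sl /= !swap_unitv -/s !inE.
by case: (e == _); case: (e == _); case: (e == _); case: (e == _).
Qed.

Lemma nrm_swap x : nrm (swap_site x) = nrm x.
Proof.
rewrite /nrm (reindex_inj (@perm_inj _ s)) /=; apply: eq_bigr => k _.
by rewrite mxE -/s sK.
Qed.

Lemma ball_swap M : [fset swap_plaq p | p in ball m M] = ball m M.
Proof.
have sub p : p \in ball m M -> swap_plaq p \in ball m M.
  rewrite !mem_ball /swap_plaq => /andP[pM pv]; rewrite pv.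
  have : s p.1.2 != s p.2 by rewrite (inj_eq perm_inj) neq_ltn pv.
  rewrite neq_ltn -/s; case: ifP => /= [/eqP <-|]; rewrite nrm_swap pM //.
  by case: (ltngtP (s _) (s _)).
apply/fsetP => p; apply/imfsetP/idP => [[p' /= p'M ->]|pM]; first exact: sub.
by exists (swap_plaq p); rewrite /= ?swap_plaqK ?sub.
Qed.

Lemma ray_swap (j : 'I_m) c e : ray (tperm a b j) c (swap_edge e) = ray j c e.
Proof.
rewrite /ray /= (inj_eq perm_inj) mxE tpermK; congr [&& _, _ & _].
apply/forallP/forallP => h k.
  by have := h (s k); rewrite mxE (inj_eq perm_inj) -/s sK.
by have := h (s k); rewrite mxE sE.
Qed.

Variables (R : realType) (t u : R).

Lemma lnZ_swap G G' M : (forall e, G' (swap_edge e) = G e) ->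
  lnZ t u G' (ball m M) = lnZ t u G (ball m M).
Proof.
move=> GG; rewrite -{1}(ball_swap M); congr ln.
exact: Z_imfset (inv_inj swap_plaqK) (inv_inj swap_edgeK) edges_swap GG.
Qed.

Lemma lnrho_swap M :
  lnrho t u (ray a false) (ray a true) (ball m M) =
  lnrho t u (ray b false) (ray b true) (ball m M).
Proof.
have r c e : ray b c (swap_edge e) = ray a c e by rewrite -[b](tpermL a) ray_swap.
rewrite /lnrho (lnZ_swap M (r false)) (lnZ_swap M (r true)).
rewrite (lnZ_swap (G := fun e => ray a false e || ray a true e)
  (G' := fun e => ray b false e || ray b true e)) //.
by move=> e; rewrite !r.
Qed.
End Symmetry.

(** * High temperature expansion *)

Section Expansion.
Variables (R : realType) (m : nat).
Implicit Types (e : pedge m) (p : pplaq m) (N : nat).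

Local Notation rep := (@rep R).
Local Notation opp := Defs.opp.
Local Notation tanh := Defs.tanh.

Lemma rep_cases (z : 'Z_2) : rep z = 1 \/ rep z = -1.
Proof. by case: z => -[|[|//]] ?; rewrite /Defs.rep /=; [left|right]. Qed.

Lemma repD (a b : 'Z_2) : rep (a + b) = rep a * rep b.
Proof.
case: a => -[|[|//]] ?; case: b => -[|[|//]] ?; rewrite /Defs.rep /=;
  rewrite ?modnn ?expr0 ?expr1; ring.
Qed.

Lemma Z2_opp (a : 'Z_2) : - a = a.
Proof. by case: a => -[|[|//]] ?; apply: val_inj. Qed.

Lemma rep0 : rep 0 = 1. Proof. by []. Qed.

Lemma repN (a : 'Z_2) : rep (- a) = rep a.
Proof.
by rewrite Z2_opp.
Qed.

Lemma rep_sq (a : 'Z_2) : rep a * rep a = 1.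
Proof. by case: (rep_cases a) => ->; ring. Qed.

Lemma rep_sum (I : Type) (r : seq I) (F : I -> 'Z_2) :
  rep (\sum_(i <- r) F i) = \prod_(i <- r) rep (F i).
Proof. exact: (big_morph rep repD rep0). Qed.

Lemma ext_val (K : choiceType) (C : {fset oriented K}) (w : {ffun C -> 'Z_2}) (c : C) :
  ext w (val c) = w c.
Proof. by rewrite /ext valK. Qed.

Lemma ext_opp (K : choiceType) (C : {fset oriented K}) (w : {ffun C -> 'Z_2}) c :
  (opp c \in C) = (c \in C) -> w \in forms C -> ext w (opp c) = - ext w c.
Proof.
rewrite inE => oC /forallP hw; have [cC|cC] := boolP (c \in C); last first.
  by rewrite /ext !insubN ?oC // oppr0.
have oc : opp c \in C by rewrite oC.
rewrite -[c]/(val [` cC]) ext_val -[opp _]/(val [` oc]) ext_val.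
have /forallP/(_ [` oc])/implyP := hw [` cC].
by move=> /(_ (eqxx _)) /eqP.
Qed.

Definition inner_edges N : {fset pedge m} :=
  [fset e in box m N `*` dirs m | e.1 + unitv e.2 \in box m N].

Lemma mem_inner N e : (e \in inner_edges N) =
  (e.1 \in box m N) && (e.1 + unitv e.2 \in box m N).
Proof. by rewrite in_fset_sep in_fsetM mem_dirs andbT. Qed.

Lemma mem_C1 N c : (c \in C1 m N) = (c.2 \in inner_edges N).
Proof.
case: c => [b [x k]]; rewrite in_fset_sep !in_fsetM mem_inner mem_dirs andbT /=.
have -> : b \in signs by rewrite !inE.
by case: b; rewrite /src /tgt /=; case: (x \in _); rewrite /= ?andbT ?andbF.
Qed.

Lemma mem_C2 N c : (c \in C2 m N) = (c.2 \in volume m N).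
Proof.
case: c => [b [[x k] l]]; rewrite !in_fset_sep !in_fsetM /=.
by have -> : b \in signs by rewrite !inE.
Qed.

(** Both orientations of a cell occur in the action; hence the doubled parameters [2 * beta] and
    [2 * kappa]. *)
Lemma sum_oriented (K : choiceType) (C : {fset oriented K}) (X : {fset K})
    (F : oriented K -> R) :
  (forall c, (c \in C) = (c.2 \in X)) -> (forall c, F (opp c) = F c) ->
  \sum_(c : C) F (val c) = 2 * \sum_(x <- X) F (pos x).
Proof.
move=> CX FO; transitivity (\sum_(c <- C) F c); first by rewrite big_seq_fsetE.
have -> : C = [fset pos x | x in X] `|` [fset opp (pos x) | x in X].
  apply/fsetP => -[b x]; rewrite in_fsetU CX /=.
  apply/idP/orP => [xX|[]/imfsetP[y /= yX [_ ->]]] //.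
  by case: b; [left|right]; apply/imfsetP; exists x.
rewrite big_fsetU_disjoint; last first.
  by apply/fdisjointP => c /imfsetP[x /= _ ->]; apply/imfsetP => -[y /= _].
rewrite !big_imfset /=; [|by move=> x y _ _ []|by move=> x y _ _ []].
by rewrite (eq_bigr (fun x => F (pos x)) (fun x _ => FO (pos x))) mulr_natl mulr2n.
Qed.

(** The gauge-invariant edge variable: the action and the Wilson lines are functions of it alone. *)
Definition spin N (sigma : {ffun C1 m N -> 'Z_2}) (phi : {ffun C0 m N -> 'Z_2}) e : R :=
  rep (ext sigma (pos e) - d0 (ext phi) (pos e)).

Lemma spin_cases N sigma phi e : @spin N sigma phi e = 1 \/ spin sigma phi e = -1.
Proof. exact: rep_cases. Qed.

Lemma rep_d1 N (sigma : {ffun C1 m N -> 'Z_2}) phi p :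
  sigma \in forms (C1 m N) -> (p.1.2 < p.2)%N ->
  rep (d1 (ext sigma) (pos p)) = \prod_(e <- edges p) spin sigma phi e.
Proof.
move=> sF; case: p => [[x k] l] /= kl.
have so e : ext sigma (opp (pos e)) = - ext sigma (pos e).
  by apply: ext_opp => //; rewrite !mem_C1.
rewrite /d1 /edges /= kl !big_cons !big_nil !so !repD !repN rep0 /spin !repD !repN.
rewrite /d0 /= !repD !repN /src /tgt /= [x + unitv l + unitv k]addrAC.
set a := rep (ext phi (pos x)); set b := rep (ext phi (pos (x + unitv k))).
set c := rep (ext phi (pos (x + unitv l))).
set d := rep (ext phi (pos (x + unitv k + unitv l))).
have aa : a * a = 1 by exact: rep_sq.
have bb : b * b = 1 by exact: rep_sq.
have cc : c * c = 1 by exact: rep_sq.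
have dd : d * d = 1 by exact: rep_sq.
move: (rep _) (rep _) (rep _) (rep _) => s1 s2 s3 s4.
(* Every corner belongs to two edges of the plaquette, so [phi] enters only through squares. *)
transitivity (s1 * (s2 * (s3 * (s4 * 1))) * (a * a) * (b * b) * (c * c) * (d * d)).
  by rewrite aa bb cc dd; ring.
by ring.
Qed.

Definition ch (x : R) : R := (expR x + expR (- x)) / 2.

Lemma ch_gt0 x : 0 < ch x.
Proof. by rewrite divr_gt0 // addr_gt0 ?expR_gt0. Qed.

Lemma tanh_gt0 (x : R) : 0 < x -> 0 < tanh x.
Proof.
move=> x0; apply: divr_gt0; last by rewrite addr_gt0 ?expR_gt0.
by rewrite subr_gt0 ltr_expR; lra.
Qed.

Lemma expR_spin x (y : R) : y = 1 \/ y = -1 -> expR (x * y) = ch x * (1 + tanh x * y).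
Proof.
have h : expR x + expR (- x) != 0 by rewrite gt_eqF ?addr_gt0 ?expR_gt0.
by case=> ->; rewrite ?mulr1 ?mulrN1 /ch /tanh; field.
Qed.

Lemma prod_expR (K : choiceType) (r : {fset K}) x (y : K -> R) :
  (forall k, k \in r -> y k = 1 \/ y k = -1) ->
  expR (x * \sum_(k <- r) y k) = ch x ^+ #|` r| * \prod_(k <- r) (1 + tanh x * y k).
Proof.
elim/fset1U_rect: r => [|k r kr IH] yr.
  by rewrite !big_seq_fset0 mulr0 expR0 cardfs0 expr0 mulr1.
rewrite !big_fsetU1 //= cardfsU1 kr mulrDr expRD exprS expR_spin; last first.
  by apply: yr; rewrite !inE eqxx.
rewrite IH; first by rewrite mulrACA.
by move=> l lr; apply: yr; rewrite !inE lr orbT.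
Qed.

Lemma gibbs_prod N (beta kappa : R) (w : {ffun C1 m N -> 'Z_2} * {ffun C0 m N -> 'Z_2}) :
  w \in configs m N -> gibbs beta kappa w =
  ch (2 * beta) ^+ #|` volume m N| * ch (2 * kappa) ^+ #|` inner_edges N| *
  (\prod_(p <- volume m N) (1 + tanh (2 * beta) * \prod_(e <- edges p) spin w.1 w.2 e)) *
  \prod_(e <- inner_edges N) (1 + tanh (2 * kappa) * spin w.1 w.2 e).
Proof.
case: w => sigma phi; rewrite finset.in_setX => /andP[/= sF pF].
have so (e : oriented (pedge m)) : ext sigma (opp e) = - ext sigma e.
  by apply: ext_opp => //; rewrite !mem_C1.
rewrite /gibbs /=.
rewrite (sum_oriented (X := volume m N) (F := fun p : oriented (pplaq m) => rep (d1 (ext sigma) p))); last 2 first.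
- exact: mem_C2.
- case=> b [[x k] l]; rewrite /d1 !rep_sum; case: b => /=; rewrite !big_cons !big_nil.
    by rewrite !so !repN.
  by rewrite !so !repN.
have -> : \sum_(e : C1 m N) rep (sigma e - d0 (ext phi) (val e)) =
    2 * \sum_(e <- inner_edges N) spin sigma phi e.
  rewrite -(sum_oriented (C := C1 m N) (F := fun e : oriented (pedge m) => rep (ext sigma e - d0 (ext phi) e))).
  - by apply: eq_bigr => e _; rewrite ext_val.
  - exact: mem_C1.
  - case=> b [x k]; rewrite so /d0 /src /tgt /=.
    by case: b => /=; rewrite !(repD, repN); ring.
rewrite !mulrA ![_ * 2]mulrC expRD !prod_expR.
- rewrite mulrACA mulrA; congr (_ * _ * _); rewrite big_seq [RHS]big_seq.
  by apply: eq_bigr => p /volume_valid pv; rewrite (rep_d1 phi sF pv).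
- by move=> e _; apply: spin_cases.
- by move=> p _; apply: rep_cases.
Qed.

(** * Summation over the edge spins of a box with [phi] fixed *)

Section Box.
Variables (N : nat) (phi : {ffun C0 m N -> 'Z_2}).

Let E := inner_edges N.

(** Over ['Z_2] a form takes equal values on opposite edges, so it amounts to a free function on
    unoriented edges. *)
Let fill (f : {ffun E -> 'Z_2}) : {ffun C1 m N -> 'Z_2} :=
  [ffun c => if insub (val c).2 is Some e then f e else 0].

Let restr (s : {ffun C1 m N -> 'Z_2}) : {ffun E -> 'Z_2} :=
  [ffun e => ext s (pos (val e))].

Let ext_fill f (e : E) : ext (fill f) (pos (val e)) = f e.
Proof.
have eC : pos (val e) \in C1 m N by rewrite mem_C1; apply: valP.
by rewrite -[pos _]/(val [` eC]) ext_val ffunE /= valK.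
Qed.

Let sum_forms (F : {ffun C1 m N -> 'Z_2} -> R) :
  \sum_(s in forms (C1 m N)) F s = \sum_(f : {ffun E -> 'Z_2}) F (fill f).
Proof.
rewrite (reindex_onto fill restr) /=; last first.
  move=> s sF; apply/ffunP => c; rewrite ffunE; case: insubP => /= [e _ ec|].
    rewrite -[s c]ext_val ffunE /=; move: ec; case: (fsval c) => b x /= ->.
    by case: b => //; rewrite -[(false, x)]/(opp (pos x)) ext_opp ?Z2_opp ?mem_C1.
  by have := valP c; rewrite mem_C1 => ->.
apply: eq_bigl => f; apply/andP; split; last first.
  by apply/eqP/ffunP => e; rewrite ffunE ext_fill.
rewrite inE; apply/forallP => c; apply/forallP => c'; apply/implyP => /eqP cc.
rewrite !ffunE cc; case: insub => [e|]; last by rewrite oppr0.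
by rewrite Z2_opp.
Qed.

(** For fixed [phi] the spins range freely and independently over 1 and -1, so the sum factorises
    and [phi] disappears. *)
Lemma sum_spin (g : pedge m -> R -> R) :
  \sum_(s in forms (C1 m N)) \prod_(e <- E) g e (spin s phi e) =
  \prod_(e <- E) (g e 1 + g e (-1)).
Proof.
rewrite sum_forms [RHS]big_seq_fsetE /=.
transitivity (\prod_(e : E) \sum_(z : 'Z_2) g (val e) (rep (z - d0 (ext phi) (pos (val e))))).
  rewrite bigA_distr_bigA; apply: eq_bigr => f _; rewrite big_seq_fsetE /=.
  by apply: eq_bigr => e _; rewrite /spin ext_fill.
apply: eq_bigr => e _; move: (d0 _ _) => z.
rewrite big_ord_recl big_ord1 !repD repN.
have -> : rep (fintype.lift ord0 ord0 : 'Z_2) = -1 by [].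
rewrite rep0; case: (rep_cases z) => ->; rewrite ?mul1r ?mulN1r ?opprK //.
by rewrite addrC.
Qed.

Lemma prod_sub (l : seq (pedge m)) (F : pedge m -> R) :
  uniq l -> {subset l <= E} ->
  \prod_(e <- l) F e = \prod_(e <- E) F e ^+ (e \in l).
Proof.
move=> ul lE; rewrite [RHS](eq_bigr (fun e => if e \in l then F e else 1)); last first.
  by move=> e _; case: (e \in l); rewrite ?expr1 ?expr0.
rewrite -[RHS]big_mkcond -[RHS]big_filter; apply: perm_big; apply: uniq_perm => //.
  by apply: filter_uniq; apply: fset_uniq.
by move=> e; rewrite mem_filter; case: (boolP (e \in l)) => //= /lE.
Qed.

Lemma edges_inner p e : p \in volume m N -> e \in edges p -> e \in E.
Proof.
case: p => [[x k] l]; rewrite mem_volume /edges => /andP[/= kl]; rewrite kl.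
case/and5P=> h1 h2 h3 h4 _; rewrite !(in_cons, in_nil) orbF => /or4P[] /eqP ->;
  rewrite /E mem_inner !mem_box /= ?h1 ?h2 ?h3 ?h4 //.
by rewrite addrAC h3.
Qed.

Lemma prod_1D (A : {fset pplaq m}) (t : R) (X : pplaq m -> R) :
  \prod_(p <- A) (1 + t * X p) =
  \sum_(P <- fpowerset A) t ^+ #|` P| * \prod_(p <- P) X p.
Proof.
elim/fset1U_rect: A => [|p A pA IH].
  by rewrite fpowerset0 big_seq_fset1 cardfs0 !big_seq_fset0 mulr1.
rewrite big_fsetU1 // sum_fpowersetU1 //= IH mulrDl mul1r mulr_sumr; congr (_ + _).
rewrite big_seq [RHS]big_seq; apply: eq_bigr => P; rewrite fpowersetE => PA.
have pP : p \notin P by apply: contra pA => /(fsubsetP PA).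
by rewrite cardfsU1 pP big_fsetU1 //= exprS mulrACA.
Qed.

Lemma sum_weights (t u : R) (l : seq (pedge m)) : u != 0 -> uniq l -> {subset l <= E} ->
  \sum_(s in forms (C1 m N))
    (\prod_(p <- volume m N) (1 + t * \prod_(e <- edges p) spin s phi e)) *
    (\prod_(e <- E) (1 + u * spin s phi e)) * (\prod_(e <- l) spin s phi e) =
  2 ^+ #|` E| * u ^+ size l * Z (wt t u (fun e => e \in l)) (volume m N).
Proof.
move=> u0 ul lE.
under eq_bigr do rewrite prod_1D !mulr_suml.
rewrite exchange_big /= /Z mulr_sumr big_seq [RHS]big_seq.
apply: eq_bigr => P; rewrite fpowersetE => /fsubsetP PV.
(* The power of the spin at [e]. Summing [(1 + u * y) * y ^+ n e] over both signs gives 2 for even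
   [n e] and [2 * u] for odd; relative to [u ^+ (e \in l)] this is the factor [edgew] on the
   boundary of [P]. *)
pose n e := (\sum_(p <- P) (e \in edges p) + (e \in l))%N.
transitivity (\sum_(s in forms (C1 m N)) t ^+ #|` P| *
    \prod_(e <- E) ((1 + u * spin s phi e) * spin s phi e ^+ n e)).
  apply: eq_bigr => s _; rewrite -!mulrA; congr (_ * _).
  rewrite (prod_sub (spin s phi) ul lE).
  have -> : \prod_(p <- P) \prod_(e <- edges p) spin s phi e =
      \prod_(e <- E) spin s phi e ^+ (\sum_(p <- P) (e \in edges p)).
    under [RHS]eq_bigr do rewrite expr_sum.
    rewrite [RHS]exchange_big /= big_seq [RHS]big_seq; apply: eq_bigr => p pP.
    by apply: prod_sub (edges_uniq p) _ => e; apply: edges_inner (PV p pP).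
  rewrite -!big_split /=; apply: eq_bigr => e _.
  by rewrite mulrCA /n exprD.
rewrite -mulr_sumr (sum_spin (fun e y => (1 + u * y) * y ^+ n e)).
rewrite [RHS]mulrCA; congr (_ * _).
have bE : {subset bdy P <= E}.
  by move=> e; rewrite mem_bdy => /bd_supp[p pP]; apply: edges_inner (PV p pP).
have c2 : 2 ^+ #|` E| = \prod_(e <- E) 2 :> R.
  by rewrite big_const_seq count_predT iter_mulr_1.
have cu : u ^+ size l = \prod_(e <- E) u ^+ (e \in l).
  by rewrite -(prod_sub (fun=> u) ul lE) big_const_seq count_predT iter_mulr_1.
rewrite c2 cu (prod_sub _ (fset_uniq _) bE) -!big_split /=; apply: eq_bigr => e _.
rewrite mulr1 mulrN1 expr1n mulr1 -signr_odd /n oddD -/(bd P e) mem_bdy.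
by rewrite /edgew; case: (bd P e); case: (e \in l) => /=; rewrite ?expr0 ?expr1; field.
Qed.
End Box.

Lemma expect_spin N (beta kappa : R) (f : observable R m) (l : seq (pedge m)) :
  0 < kappa -> uniq l -> {subset l <= inner_edges N} ->
  (forall w, w \in configs m N -> f (ext w.1) (ext w.2) = \prod_(e <- l) spin w.1 w.2 e) ->
  let Zl l := Z (wt (tanh (2 * beta)) (tanh (2 * kappa)) (fun e => e \in l)) (volume m N) in
  Zl [::] != 0 ->
  expect N beta kappa f = tanh (2 * kappa) ^+ size l * (Zl l / Zl [::]).
Proof.
move=> k0 ul lE hf Zl Z0.
have u0 : tanh (2 * kappa) != 0 :> R.
  by rewrite gt_eqF // tanh_gt0 // mulr_gt0.
(* Common to numerator and partition function: hyperbolic cosines, the number of [phi], and a factor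
   2 per edge. *)
pose c : R := ch (2 * beta) ^+ #|` volume m N| * ch (2 * kappa) ^+ #|` inner_edges N| *
  (#|forms (C0 m N)|%:R * 2 ^+ #|` inner_edges N|).
have total g l' : uniq l' -> {subset l' <= inner_edges N} ->
    (forall w, w \in configs m N -> g w = \prod_(e <- l') spin w.1 w.2 e) ->
    \sum_(w in configs m N) gibbs beta kappa w * g w =
    c * (tanh (2 * kappa) ^+ size l' * Zl l').
  move=> ul' lE' hg.
  transitivity (\sum_(phi in forms (C0 m N)) \sum_(s in forms (C1 m N))
      gibbs beta kappa (s, phi) * g (s, phi)).
    rewrite exchange_big pair_big /=; apply: eq_big => [[s phi]|[s phi] _] //.
    by rewrite finset.in_setX.
  rewrite (eq_bigr (fun=> ch (2 * beta) ^+ #|` volume m N| * ch (2 * kappa) ^+ #|` inner_edges N| *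
     (2 ^+ #|` inner_edges N| * tanh (2 * kappa) ^+ size l' * Zl l'))); last first.
    move=> phi pF; rewrite -(sum_weights phi _ u0 ul' lE') mulr_sumr; apply: eq_bigr => s sF.
    have sp : (s, phi) \in configs m N by rewrite finset.in_setX sF pF.
    by rewrite gibbs_prod // hg // -!mulrA.
  by rewrite sumr_const -[LHS]mulr_natl /c mulrCA -!mulrA.
have c0 : c != 0.
  rewrite !mulf_neq0 ?expf_neq0 ?gt_eqF ?ch_gt0 // ltr0n; apply/card_gt0P.
  exists [ffun=> 0]; rewrite inE; apply/forallP => a; apply/forallP => b.
  by rewrite !ffunE oppr0 eqxx implybT.
rewrite /expect /mu; under eq_bigr do rewrite mulrAC.
rewrite -mulr_suml (total (fun w => f (ext w.1) (ext w.2)) l ul lE hf).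
have -> : \sum_(w' in configs m N) gibbs beta kappa w' = c * (tanh (2 * kappa) ^+ 0 * Zl [::]).
  rewrite -[0%N]/(size (@nil (pedge m))) -(total (fun=> 1)) //.
    by apply: eq_bigr => w _; rewrite mulr1.
  by move=> w _; rewrite big_nil.
by rewrite expr0 mul1r invfM mulrACA divff // mul1r mulrA.
Qed.

End Expansion.

(** * Wilson lines *)

Section Chains.
Variables (K : choiceType) (M : zmodType) (F : K -> M).

(** Both [eval_chain] and [bd1] are instances by conversion, so additivity is proved once. *)
Definition chain_sum (c : {freeg K / int}) : M :=
  \sum_(k <- freeg.dom c) F k *~ coeff k c.

Lemma chain_sumE (s : seq K) (c : {freeg K / int}) :
  uniq s -> {subset freeg.dom c <= s} -> chain_sum c = \sum_(k <- s) F k *~ coeff k c.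
Proof.
move=> us cs; rewrite (bigID (fun k => k \in freeg.dom c)) /= [X in _ + X]big1 ?addr0.
  rewrite -big_filter; apply: perm_big; apply: uniq_perm; rewrite ?uniq_dom ?filter_uniq //.
  by move=> k; rewrite mem_filter; case: (boolP (k \in _)) => //= /cs.
by move=> k kc; rewrite coeff_outdom // mulr0z.
Qed.

Lemma chain_sumD c c' : chain_sum (c + c') = chain_sum c + chain_sum c'.
Proof.
pose s := undup (freeg.dom (c + c') ++ freeg.dom c ++ freeg.dom c').
rewrite !(@chain_sumE s) ?undup_uniq //; last first.
- by move=> k; rewrite mem_undup !mem_cat => ->; rewrite ?orbT.
- by move=> k; rewrite mem_undup !mem_cat => ->; rewrite ?orbT.
- by move=> k; rewrite mem_undup !mem_cat => ->; rewrite ?orbT.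
rewrite -big_split /=; apply: eq_bigr => k _.
by rewrite coeffD mulrzDr.
Qed.

Lemma chain_sum0 : chain_sum 0 = 0.
Proof. by rewrite /chain_sum dom0 big_nil. Qed.

Lemma chain_sumN c : chain_sum (- c) = - chain_sum c.
Proof. by apply/eqP; rewrite -subr_eq0 opprK -chain_sumD addNr chain_sum0. Qed.

Lemma chain_sumU k : chain_sum << k >> = F k.
Proof. by rewrite /chain_sum domU1 big_seq1 coeffU eqxx mulr1n mulr1z. Qed.
End Chains.

Section Wilson.
Variables (R : realType) (m : nat).
Implicit Types (sigma : oriented (pedge m) -> 'Z_2) (phi : oriented (site m) -> 'Z_2).
Implicit Types (c : chain1 m) (e : pedge m).

Lemma wilsonD c c' sigma phi :
  wilson (R := R) (c + c') sigma phi = wilson c sigma phi * wilson c' sigma phi.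
Proof.
rewrite /wilson -repD; congr Defs.rep.
rewrite -[bd1 (c + c')]/(chain_sum _ (c + c')) chain_sumD.
rewrite -![eval_chain _ _]/(chain_sum _ _) !chain_sumD.
by rewrite opprD addrACA.
Qed.

Lemma wilsonN c sigma phi : wilson (R := R) (- c) sigma phi = wilson c sigma phi.
Proof.
rewrite /wilson -[in RHS]repN; congr Defs.rep.
rewrite -[bd1 (- c)]/(chain_sum _ (- c)) chain_sumN.
rewrite -![eval_chain _ _]/(chain_sum _ _) !chain_sumN.
by rewrite opprB opprK addrC.
Qed.

Lemma wilson0 sigma phi : wilson (R := R) 0 sigma phi = 1.
Proof.
rewrite /wilson -[bd1 0]/(chain_sum _ 0) chain_sum0.
by rewrite -![eval_chain _ _]/(chain_sum _ _) !chain_sum0 subr0.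
Qed.

Lemma wilsonU e sigma phi :
  wilson (R := R) << e >> sigma phi = Defs.rep (sigma (pos e) - d0 phi (pos e)).
Proof.
rewrite /wilson -[bd1 << e >>]/(chain_sum _ << e >>) chain_sumU.
rewrite -![eval_chain _ _]/(chain_sum _ _) chain_sumU chain_sumD chain_sumN !chain_sumU.
by [].
Qed.

Lemma wilson_segment (x : site m) i L sigma phi :
  wilson (R := R) (segment x i L) sigma phi =
  \prod_(e <- seg x i L) Defs.rep (sigma (pos e) - d0 phi (pos e)).
Proof.
rewrite /segment /seg big_map -[L in iota _ L]subn0 -/(index_iota 0 L) big_mkord.
rewrite (big_morph (fun c => wilson (R := R) c sigma phi)
  (fun c c' => wilsonD c c' sigma phi) (wilson0 sigma phi)).
by apply: eq_bigr => k _; rewrite wilsonU.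
Qed.

Lemma seg_cat (x : site m) i (a b : nat) :
  seg x i (a + b) = seg x i a ++ seg (x + unitv i *+ a) i b.
Proof.
rewrite /seg iotaD map_cat; congr (_ ++ _).
rewrite add0n -[a in iota a b]addn0 iotaDl -map_comp; apply: eq_map => n /=.
by rewrite mulrnDr addrA.
Qed.

Lemma wilson_rect1 i j r T sigma phi :
  wilson (R := R) (rect1 i j r T) sigma phi =
  \prod_(e <- half1 i j r T) Defs.rep (sigma (pos e) - d0 phi (pos e)).
Proof.
by rewrite /rect1 /half1 !wilsonD wilsonN !wilson_segment !big_cat /= mulrA.
Qed.

Lemma wilson_rect i j r T sigma phi :
  wilson (R := R) (rect i j r T) sigma phi =
  \prod_(e <- half1 i j r T ++ half2 i j r T) Defs.rep (sigma (pos e) - d0 phi (pos e)).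
Proof.
rewrite /rect /half1 /half2 !wilsonD !wilsonN !wilson_segment.
rewrite {1 3}[(2 * r)%N]mul2n -addnn !seg_cat !big_cat /= add0r; ring.
Qed.

Lemma wilson_rect2 i j r T sigma phi :
  wilson (R := R) (rect2 i j r T) sigma phi =
  \prod_(e <- half2 i j r T) Defs.rep (sigma (pos e) - d0 phi (pos e)).
Proof.
rewrite /rect2 wilsonD wilsonN wilson_rect wilson_rect1 big_cat /= mulrAC.
(* Subtracting [rect1] multiplies by its Wilson line again, so the first half appears squared. *)
by rewrite -rep_sum rep_sq mul1r.
Qed.

Lemma seg_disjoint (x y : site m) k l a b :
  (k != l) || (x 0 k + a%:Z <= y 0 k) || [exists c, (c != k) && (x 0 c != y 0 c)] ->
  has (mem (seg x k a)) (seg y l b) = false.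
Proof.
move=> h; apply/negbTE/hasPn => e ey; apply/negP => /= ex.
have kl : k = l by move: ex ey; rewrite !mem_seg => /andP[/eqP <- _] /andP[/eqP <-].
subst k; move: h; rewrite eqxx /= => /orP[xy|/existsP[c /andP[cl /eqP xc]]].
  have := segP l ex; have := segP l ey; rewrite eqxx.
  by move: (x 0 l) (y 0 l) (e.1 0 l) xy; lia.
by apply: xc; have := segP c ex; have := segP c ey; rewrite (negbTE cl) => -> ->.
Qed.

Lemma half_uniq (i j : 'I_m) (r T : nat) : i != j -> (0 < r)%N -> (0 < T)%N ->
  uniq (half1 i j r T ++ half2 i j r T).
Proof.
move=> ij r0 T0; have ijF := negbTE ij; have jiF : (j == i) = false by rewrite eq_sym.
have ex (c : 'I_m) (P : pred 'I_m) : P c -> [exists c, P c] by move=> Pc; apply/existsP; exists c.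
have coord := (mxE, unitvnE, eqxx, mul1n, mul0n, ijF, jiF, add0r, addr0).
rewrite /half1 /half2 -!catA !cat_uniq !seg_uniq !has_cat /=.
rewrite !seg_disjoint ?ijF ?jiF //= ?orbT //.
all: rewrite ?coord ?lexx ?orbT //.
all: try (apply/orP; right; apply: (ex i); rewrite !coord; lia).
all: try (apply: (ex j); rewrite !coord; lia).
by apply/orP; right; apply: (ex j); rewrite !coord; lia.
Qed.
End Wilson.

Lemma cancel_prod (F : fieldType) (p q b c y : F) : p != 0 -> q != 0 -> y != 0 ->
  p * b * (q * c) / (p * q * y) = b * c / y.
Proof. by move=> p0 q0 y0; field; rewrite y0 p0 q0. Qed.

(** * Infinite volume and the limit of rho *)

Section Limit.
Variables (R : realType) (m : nat) (beta kappa tb : R).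
Hypotheses (m_gt2 : (2 < m)%N) (beta_gt0 : 0 < beta) (kappa_gt0 : 0 < kappa)
  (tb_le : 8 * (8 * m.-1)%N%:R * tb <= 8 / 9) (t_lt : Defs.tanh (2 * beta) < tb).
Implicit Types (e : pedge m) (i j : 'I_m).

Let t := Defs.tanh (2 * beta).
Let u := Defs.tanh (2 * kappa).

Let t0 : 0 < t. Proof. by rewrite tanh_gt0 // mulr_gt0. Qed.
Let u0 : 0 < u. Proof. by rewrite tanh_gt0 // mulr_gt0. Qed.
Let tb0 : 0 < tb. Proof. exact: lt_trans t_lt. Qed.
Let u1 : u <= 1.
Proof.
rewrite /u /Defs.tanh ler_pdivrMr ?addr_gt0 ?expR_gt0 // mul1r.
by have := expR_gt0 (- (2 * kappa)); lra.
Qed.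

Local Notation good := (good t u tb).
Local Notation good_rect := (good_rect t u tb).

(** As [x = tb / t > 1], some power [x ^+ l] exceeds [u^-1 ^+ 4], which is what [wt_le] asks of
    rectangles with sides at least [l]. *)
Lemma good_large : exists l : nat, good (@pred0 (pedge m)) /\
  forall i j r T, i != j -> (l <= r)%N -> (l <= T)%N -> good_rect i j r T.
Proof.
pose x := tb / t; have x1 : 1 < x by rewrite ltr_pdivlMr // mul1r.
have x0 : 0 < x by apply: lt_trans x1.
have tx : t * x = tb by rewrite /x mulrCA divff ?mulr1 // gt_eqF.
have [l l0 ul] : exists2 l, (0 < l)%N & u^-1 ^+ 4 <= x ^+ l.
  have u4 : 0 < u ^+ 4 by rewrite exprn_gt0.
  have hx : `|x^-1| < 1 by rewrite gtr0_norm ?invr_gt0 // invf_lt1.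
  have /cvgrPdist_lt/(_ _ u4)[l _ hl] := cvg_expr hx.
  exists l.+1 => //; have /= := hl l.+1 (leqnSn l).
  rewrite sub0r normrN ger0_norm ?exprn_ge0 ?invr_ge0 ?(ltW x0) // => h.
  by rewrite exprVn -[leRHS]invrK lef_pV2 ?posrE ?invr_gt0 ?exprn_gt0 // -exprVn ltW.
have gd i j T L (G : pred (pedge m)) : i != j -> (l <= T)%N -> (l <= L)%N ->
    (forall e, G e -> sides i j T L e || sides j i L T e) -> good G.
  move=> ij lT lL hG; split.
  - exact: wt0.
  - by move=> K; apply/ltW/wt_gt0.
  - by move=> K Q; apply: wtU.
  - by move=> K; rewrite -tx; apply: wt_le ij lT lL hG _ _ _ _.
exists l; split.
  (* The empty edge set lies on any rectangle, here an [l] by [l] square. *)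
  have m0 : (0 < m)%N := ltnW (ltnW m_gt2).
  have m1 : (1 < m)%N := ltnW m_gt2.
  by apply: (gd (Ordinal m0) (Ordinal m1) l l).
move=> i j r T ij lr lT; have lr2 : (l <= 2 * r)%N by apply: leq_trans lr (leq_pmull r _).
split; apply: (gd i j T (2 * r)%N) => // e he; apply: half_sides => //.
  by rewrite -/(halfp1 i j r T e) he.
by rewrite -/(halfp2 i j r T e) he orbT.
Qed.

Lemma half_nrm i j r T e : e \in half1 i j r T ++ half2 i j r T ->
  (nrm e.1 <= T + 2 * r)%N.
Proof.
have segn x k a c : (nrm x + a <= c)%N -> e \in seg x k a -> (nrm e.1 <= c)%N.
  move=> xc /mapP[n]; rewrite mem_iota => /andP[_ na] -> /=.
  apply: leq_trans (nrmD _ _) (leq_trans _ xc); rewrite leq_add2l.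
  by apply: leq_trans (nrm_unitvn _ _) (ltnW _).
have n0 : nrm (0 : site m) = 0%N by apply/eqP; rewrite -leqn0 -(mulr0n (unitv i)) nrm_unitvn.
have ni n := nrm_unitvn i n; have nj n := nrm_unitvn j n.
rewrite !mem_cat => /orP[] /or3P[]; apply: segn; rewrite ?n0.
- by rewrite add0n leq_addr.
- by have := ni T; lia.
- by lia.
- by have := nj (2 * r)%N; lia.
- rewrite mul2n -addnn addnA leq_add2r; apply: leq_trans (nrmD _ _) _.
  exact: leq_add.
- by rewrite mul2n -addnn addnA leq_add2r (leq_trans (nj r)) // leq_addl.
Qed.

(** Once the box contains the path, the expectation is exactly [u ^+ size l] times the exponential
    of the convergent difference. *)
Lemma infvol_path (l : seq (pedge m)) (L : nat) (f : observable R m) :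
  good (@pred0 (pedge m)) -> good (fun e => e \in l) -> uniq l ->
  (forall e, e \in l -> nrm e.1 <= L)%N ->
  (forall sigma phi, f sigma phi =
    \prod_(e <- l) Defs.rep (sigma (pos e) - d0 phi (pos e))) ->
  exists2 a : R, (fun N => lnZ t u (fun e => e \in l) (volume m N) -
                           lnZ t u pred0 (volume m N)) @ \oo --> a &
    infvol beta kappa f = u ^+ size l * expR a.
Proof.
move=> g0 gl ul lL hf; have := lnZ_cvg m_gt2 (ltW tb0) tb_le gl g0 lL.
move=> /cvg_ex[a ha]; exists a => //.
apply: cvg_lim => //.
have : (fun N => u ^+ size l * expR (lnZ t u (fun e => e \in l) (volume m N) -
                           lnZ t u pred0 (volume m N))) @ \oo --> u ^+ size l * expR a.
  by apply: cvgMl_tmp; apply: (cvg_comp _ _ ha); apply: continuous_expR.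
apply: cvg_trans; apply: near_eq_cvg; exists L.+1 => // N /= LN.
have Zp G : good G -> 0 < Z (wt t u G) (volume m N) by apply: Z_gt0.
have Z0 : Z (wt t u (fun e => e \in [::])) (volume m N) = Z (wt t u pred0) (volume m N).
  by congr Z; apply/funext => K; apply: eq_wt.
rewrite (expect_spin (l := l)) //.
- by rewrite Z0 /lnZ -ln_div ?posrE ?Zp // lnK ?posrE ?divr_gt0 ?Zp.
- move=> e el; rewrite mem_inner !mem_box; have eL := lL e el.
  rewrite (leq_trans eL) ?(ltnW LN) //=.
  have e1 : (nrm (unitv e.2) <= 1)%N by rewrite -[unitv e.2]mulr1n nrm_unitvn.
  by apply: leq_trans (nrmD _ _) (leq_trans (leq_add eL e1) _); rewrite addn1.
- by rewrite Z0 gt_eqF ?Zp.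
Qed.

Lemma rho_volume i j r T : i != j -> (0 < r)%N -> (0 < T)%N -> good_rect i j r T ->
  exists2 a : R, (fun N => lnrho t u (halfp1 i j r T) (halfp2 i j r T) (volume m N))
      @ \oo --> a &
    rho beta kappa i j r T = expR a.
Proof.
move=> ij r0 T0 [g1 g2 g12 g0]; have := half_uniq ij r0 T0.
set l1 := half1 i j r T; set l2 := half2 i j r T => ul.
have l12 : (fun e => e \in l1 ++ l2) = (fun e => halfp1 i j r T e || halfp2 i j r T e).
  by apply/funext => e; rewrite mem_cat.
have nl := @half_nrm i j r T.
have [ul1 ul2] : uniq l1 /\ uniq l2 by move: ul; rewrite cat_uniq => /and3P[].
have n1 e : e \in l1 -> (nrm e.1 <= T + 2 * r)%N by move=> el; apply: nl; rewrite mem_cat el.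
have n2 e : e \in l2 -> (nrm e.1 <= T + 2 * r)%N.
  by move=> el; apply: nl; rewrite mem_cat el orbT.
have g12' : good (fun e => e \in l1 ++ l2) by rewrite l12.
have [a1 ha1 w1] := infvol_path g0 g1 ul1 n1 (@wilson_rect1 R m i j r T).
have [a2 ha2 w2] := infvol_path g0 g2 ul2 n2 (@wilson_rect2 R m i j r T).
have [a ha w] := infvol_path g0 g12' ul nl (@wilson_rect R m i j r T).
exists (a1 + a2 - a).
  rewrite l12 in ha; pose d G N := lnZ t u G (volume m N) - lnZ t u pred0 (volume m N).
  have -> : (fun N => lnrho t u (halfp1 i j r T) (halfp2 i j r T) (volume m N)) =
      (fun N => d (halfp1 i j r T) N + d (halfp2 i j r T) N -
        d (fun e => halfp1 i j r T e || halfp2 i j r T e) N).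
    by apply/funext => N; rewrite /lnrho /d; ring.
  by apply: cvgB => //; apply: cvgD.
rewrite /rho w1 w2 w size_cat exprD !expRD expRN.
have := expR_gt0 a; move: (expR a) => y y0.
have u1' : 0 < u ^+ size l1 by rewrite exprn_gt0.
have u2' : 0 < u ^+ size l2 by rewrite exprn_gt0.
by rewrite cancel_prod // gt_eqF.
Qed.

(** The second limit identifies [x] by a sequence in which neither [i] nor [r] and [T] occur. *)
Lemma rho_cvg i j (r T : nat -> nat) C : i != j ->
  (forall n, n < r n)%N -> (forall n, n < T n)%N ->
  (\forall n \near \oo, T n <= C * r n)%N ->
  exists2 x : R, (fun n => rho beta kappa i j (r n) (T n)) @ \oo --> expR x &
    (fun M => 2 * lnrho t u (ray j false) (ray j true) (ball m M)) @ \oo --> x.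
Proof.
move=> ij rn Tn TC; have [l [g0 gl]] := good_large.
have [y [K [y01 K0 hK]]] := lnrho_volume t u m_gt2 (ltW tb0) tb_le C.
have /andP[y0 y1] := y01.
have [||x hx hM] := @dist_limit R (fun n => ln (rho beta kappa i j (r n) (T n)))
  (fun M => 2 * lnrho t u (ray j false) (ray j true) (ball m M))
  (fun M => K * (y ^+ M + y ^+ M)).
- rewrite -(mulr0 K) -(addr0 0); apply: cvgMl_tmp; apply: cvgD; apply: cvg_expr;
    by rewrite gtr0_norm.
- move=> M; near=> n.
  have lr : (l <= r n)%N by apply: leq_trans (ltnW (rn n)); near: n; exists l.
  have lT : (l <= T n)%N by apply: leq_trans (ltnW (Tn n)); near: n; exists l.
  have Mr : (M.+1 < r n)%N by apply: leq_ltn_trans (rn n); near: n; exists M.+1.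
  have MT : (2 * M + 2 <= T n)%N.
    by apply: leq_trans (ltnW (Tn n)); near: n; exists (2 * M + 2)%N.
  have r0 : (0 < r n)%N by apply: leq_ltn_trans (rn n).
  have T0 : (0 < T n)%N by apply: leq_ltn_trans (Tn n).
  have gd := gl i j (r n) (T n) ij lr lT.
  have [a ha ->] := rho_volume ij r0 T0 gd; rewrite expRK.
  have TCn : (T n <= C * r n)%N by near: n.
  pose c := 2 * lnrho t u (ray j false) (ray j true) (ball m M).
  (* The bound of [lnrho_volume] is uniform in [N], so it passes to the infinite volume at fixed [n]
     and [M]. *)
  have hlim : (fun N => `|lnrho t u (halfp1 i j (r n) (T n)) (halfp2 i j (r n) (T n))
      (volume m N) - c|) @ \oo --> `|a - c|.
    by apply: cvg_norm; apply: cvgB => //; apply: cvg_cst.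
  rewrite -(cvg_lim _ hlim) //; apply: limr_le; first by apply/cvg_ex; exists `|a - c|.
  exists (r n + T n + M.+2)%N => // N /= NN.
  apply: le_trans (hK i j (r n) (T n) M N ij gd TCn Mr MT NN) _.
  rewrite ler_wpM2l // lerD2l ler_wiXn2l ?(ltW y0) ?(ltW y1) //.
  by apply: ltnW; apply: ltn_trans Mr.
exists x => //; have : (fun n => expR (ln (rho beta kappa i j (r n) (T n)))) @ \oo --> expR x.
  by apply: (cvg_comp _ _ hx); apply: continuous_expR.
apply: cvg_trans; apply: near_eq_cvg; near=> n.
have lr : (l <= r n)%N by apply: leq_trans (ltnW (rn n)); near: n; exists l.
have lT : (l <= T n)%N by apply: leq_trans (ltnW (Tn n)); near: n; exists l.
have r0 : (0 < r n)%N by apply: leq_ltn_trans (rn n).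
have T0 : (0 < T n)%N by apply: leq_ltn_trans (Tn n).
have [a _ ->] := rho_volume ij r0 T0 (gl i j (r n) (T n) ij lr lT).
by rewrite expRK.
Unshelve. all: by end_near. Qed.

End Limit.

Lemma tanh_le (R : realType) (x y : R) : x <= y -> Defs.tanh x <= Defs.tanh y.
Proof.
have h (z : R) : Defs.tanh z = 1 - 2 / (expR (2 * z) + 1).
  have -> : 2 * z = z + z by ring.
  rewrite /Defs.tanh expRD expRN; have := expR_gt0 z.
  move: (expR z) => w w0; have w1 : 0 < w * w + 1 by rewrite addr_gt0 ?mulr_gt0.
  by field; rewrite !gt_eqF.
move=> xy; rewrite !h lerD2l lerN2 ler_pM2l // lef_pV2 ?posrE ?addr_gt0 ?expR_gt0 //.
by rewrite lerD2r ler_expR ler_pM2l.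
Qed.

Lemma tanh_lt_beta0 (R : realType) (m : nat) (beta : R) :
  (2 < m)%N -> 0 < beta < beta0_conf R m ->
  Defs.tanh (2 * beta) < ((8 * m - 12)%:R ^+ 2)^-1.
Proof.
move=> m2 /andP[b0]; rewrite /beta0_conf; set S := [set b | _] => bS.
(* The supremum of the empty set is 0 by convention, which [0 < beta] excludes. *)
have S0 : S !=set0.
  by apply/set0P/eqP => SE; move: bS; rewrite SE sup0 ltNge ltW.
have [b [_ [hb _]] bb] := sup_gt S0 bS.
have M0 : 0 < (8 * m - 12)%:R ^+ 2 :> R by rewrite exprn_gt0 // ltr0n; lia.
rewrite -[ltRHS]mul1r ltr_pdivlMr // mulrC; apply: le_lt_trans hb.
by rewrite ler_pM2l // tanh_le // ler_pM2l // ltW.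
Qed.

Lemma confinement_le (R : realType) (m : nat) : (2 < m)%N ->
  8 * (8 * m.-1)%N%:R * ((8 * m - 12)%:R ^+ 2)^-1 <= 8 / 9 :> R.
Proof.
move=> m2; have [k ->] : exists k, m = (k + 3)%N by exists (m - 3)%N; lia.
have -> : (8 * (k + 3) - 12 = 8 * k + 12)%N by lia.
have -> : ((k + 3).-1 = k + 2)%N by lia.
have -> : (8 * (k + 2))%N%:R = 8 * (k%:R + 2) :> R by rewrite natrM natrD.
have -> : (8 * k + 12)%N%:R = 8 * k%:R + 12 :> R by rewrite natrD natrM.
have := ler0n R k; move: (k%:R : R) => x x0.
by rewrite ler_pdivrMr; [nra|apply: exprn_gt0; lra].
Qed.

(** The limsup is the infimum of the tail suprema, so some tail supremum is already finite. *)
Lemma limn_esup_bounded (R : realType) (a b : nat -> nat) :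
  (forall n, 0 < b n)%N ->
  (limn_esup (fun n => ((a n)%:R / (b n)%:R : R)%:E) < +oo)%E ->
  exists C, \forall n \near \oo, (a n <= C * b n)%N.
Proof.
move=> b0; set v := (fun n => _ : \bar R); rewrite limn_esup_lim.
rewrite (cvg_lim _ (ereal_nonincreasing_cvgn (nonincreasing_esups v))) //.
move=> /ereal_inf_lt[_ [k _ <-]] hk.
have [c hc] : exists c : R, forall n, (k <= n)%N -> (v n <= c%:E)%E.
  case E : (esups v k) hk => [c| |] // _; [exists c|exists 0] => n kn;
    have : (v n <= esups v k)%E by apply: ereal_sup_ubound; exists n.
    by rewrite E.
  by rewrite E leeNy_eq.
exists (Num.truncn `|c|).+1; exists k => // n /= /hc; rewrite lee_fin.
rewrite ler_pdivrMr ?ltr0n // => h; rewrite -(ler_nat R) natrM.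
apply: le_trans h _; rewrite ler_wpM2r // (le_trans (ler_norm c)) // ltW //.
exact: truncnS_gt.
Qed.

Lemma increasing_gt (f : nat -> nat) : (forall n, 0 < f n)%N ->
  {homo f : a b / (a < b)%N} -> forall n, (n < f n)%N.
Proof.
by move=> f0 hf; elim=> [|n IHn] //; apply: leq_ltn_trans IHn (hf _ _ (ltnSn n)).
Qed.

Theorem theorem1p2 (R : realType) (m : nat) (hm : (3 <= m)%N)
    (beta kappa : R) (hbeta : 0 < beta < beta0_conf R m) (hkappa : 0 < kappa) :
  exists rho_lim : R,
    (forall (i j : 'I_m) (r T : nat -> nat),
       i != j ->
       (forall n, 0 < r n)%N -> (forall n, 0 < T n)%N ->
       {homo r : a b / (a < b)%N} -> {homo T : a b / (a < b)%N} ->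
       (limn_esup (fun n => ((T n)%:R / (r n)%:R : R)%:E) < +oo)%E ->
       rho beta kappa i j (r n) (T n) @[n --> \oo] --> rho_lim)
    /\ 0 < rho_lim.
Proof.
have b0 : 0 < beta by case/andP: hbeta.
have cvg := rho_cvg hm b0 hkappa (confinement_le R hm) (tanh_lt_beta0 hm hbeta).
have m0 : (0 < m)%N := ltnW (ltnW hm).
pose i0 := Ordinal m0; pose j0 := Ordinal (ltnW hm : (1 < m)%N).
(* A reference family, [n + 1] for both sequences in the first two directions, fixes the value of
   the limit. *)
have [||||x0 _ hx0] := cvg i0 j0 S S 1%N => //.
  by exists 0%N => // n _ /=; rewrite mul1n.
exists (expR x0); split; last exact: expR_gt0.
move=> i j r T ij r0 T0 hr hT /(limn_esup_bounded r0)[C hC].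
have [x hx hx'] := cvg i j r T C ij (increasing_gt r0 hr) (increasing_gt T0 hT) hC.
(* Exchanging [j] and [j0] preserves the balls, so both values are limits of the same sequence. *)
have sw := lnrho_swap j j0; suff -> : x0 = x by [].
apply: cvg_unique hx0 _ => //.
by move: hx'; under eq_fun do rewrite sw.
Qed.
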